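(* Let $p>2$ be a prime. (1) Let $k\geq 1$, $a\in\mathbb{Z}_p^{\times}$, and let $A=A_{p^k,a}$. Then $$G(A,\mathrm{O}(A))=\begin{cases}0, & p^k\equiv 3 \pmod 4,\\ \left(\frac{a}{p}\right)^k\sqrt{|A|}, & p^k\equiv 1 \pmod 4.\end{cases}$$ (2) Let $A$ be a $p$-elementary form of dimension $m>1$. If $A$ contains a nonzero isotropic vector, then $$G(A,\mathrm{O}(A))=\begin{cases}0, & p\equiv 3 \pmod 4,\\ 2\left(\frac{2\delta}{p}\right)^m\left(\frac{d(A)}{p}\right)\sqrt{|A|}, & p\equiv 1 \pmod 4,\end{cases}$$ where, for $p\equiv 1\pmod 4$, $\delta\in\mathbb{F}_p$ is a square root of $-1$. If $A$ is the anisotropic plane (a $2$-dimensional $p$-elementary form with no nonzero isotropic vector), then $G(A,\mathrm{O}(A))=(-1)^{(p+1)/2}p$. (3) Let $A=A_1\oplus A_2$ (orthogonal direct sum), where $A_1=A_{p^k,a}$ with $k>1$ and $a\in\mathbb{Z}_p^\times$, and $A_2$ is a $p$-elementary form (of some dimension $m\ge 1$). Then $$G(A,\mathrm{O}(A))=G(A_1,\mathrm{O}(A_1))\cdot G(A_2,\mathrm{O}(A_2)).$$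
   Context: A finite quadratic form is a finite abelian group $A$ with a map $q:A\to\mathbb{Q}/\mathbb{Z}$ such that $q(nx)=n^2q(x)$ for $n\in\mathbb{Z}$ and such that $(x,y):=q(x+y)-q(x)-q(y)$ is a symmetric bilinear form $A\times A\to\mathbb{Q}/\mathbb{Z}$; all forms are assumed nondegenerate (the bilinear form is nondegenerate). $\mathrm{O}(A)$ is the group of group automorphisms of $A$ preserving $q$. Write $e(z)=\exp(2\pi i z)$ for $z\in\mathbb{Q}/\mathbb{Z}$. For a subgroup $\Gamma\subset\mathrm{O}(A)$ the equivariant Gauss sum is $G(A,\Gamma)=\sum_{[x]\in\Gamma\backslash A}\sum_{y\in\Gamma x}e((x,y))$ (independent of the choice of representative $x$ of each orbit). For $p$ odd, a quadratic form on a $p$-group is determined by its bilinear form via $q(x)=2^{-1}(x,x)$, with $2^{-1}$ the inverse of $2$ modulo the exponent of $A$. $A_{p^k,a}$ denotes $\mathbb{Z}/p^k$ with bilinear form $(x,y)=axy/p^k$. A $p$-elementary form is such a form on an elementary abelian $p$-group $A\cong(\mathbb{Z}/p)^m$; it is regarded as a quadratic space over $\mathbb{F}_p$ of dimension $m$ with $\mathbb{F}_p$-valued bilinear form $p(x,y)$, and $d(A)\in\mathbb{F}_p^\times/(\mathbb{F}_p^\times)^2$ is the determinant of its Gram matrix. A vector $x$ is isotropic if $(x,x)=0$. $\left(\frac{\cdot}{p}\right)$ is the Legendre symbol. *)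

(* Defs.v *)
From HB Require Import structures.
From mathcomp Require Import all_boot all_order all_fingroup all_algebra.
From mathcomp Require Import complex ring.
From mathcomp Require Import reals trigo.

Set Implicit Arguments.
Unset Strict Implicit.
Unset Printing Implicit Defensive.

Import Order.TTheory GRing.Theory Num.Theory.

Local Open Scope ring_scope.
Local Open Scope quotient_scope.
Local Open Scope complex_scope.

Definition rat_int : pred rat := fun x => x \is a Num.int.

Fact rat_int_zmod_closed : zmod_closed rat_int.
Proof. by split=> [|x y]; [exact: rpred0 | exact: rpredB]. Qed.

HB.instance Definition _ :=
  GRing.isZmodClosed.Build rat rat_int rat_int_zmod_closed.

Definition QZ := Quotient.quot (GRing.ZmodClosed.clone rat rat_int _).
HB.instance Definition _ := GRing.Zmodule.on QZ.

Definition toQZ (x : rat) : QZ := \pi x.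

Lemma toQZ_eq (x y : rat) : (toQZ x == toQZ y) = (x - y \is a Num.int).
Proof. by rewrite /toQZ -Quotient.idealrBE. Qed.

Lemma toQZD (x y : rat) : toQZ (x + y) = toQZ x + toQZ y.
Proof. exact: raddfD. Qed.

Definition QZrepr (z : QZ) : rat := generic_quotient.repr z.

Lemma QZreprK (z : QZ) : toQZ (QZrepr z) = z.
Proof. exact: reprK. Qed.

Definition eQZ (R : realType) (z : QZ) : R[i] :=
  cos (2 * pi * ratr (QZrepr z)) +i* sin (2 * pi * ratr (QZrepr z)).

Definition bil (A : zmodType) (q : A -> QZ) (x y : A) : QZ :=
  q (x + y) - q x - q y.

Definition finite_quadratic_form (A : finZmodType) (q : A -> QZ) : Prop :=
  [/\ forall (n : int) (x : A), q (x *~ n) = q x *~ (n ^+ 2),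
      forall x y, bil q x y = bil q y x,
      forall x y z, bil q (x + y) z = bil q x z + bil q y z
    & forall x, (forall y, bil q x y = 0) -> x = 0].

Section OrthogonalGroup.
Variables (A : finZmodType) (q : A -> QZ).

Definition orth : {set {perm A}} :=
  [set s : {perm A} | [forall x, forall y, s (x + y) == s x + s y]
                      && [forall x, q (s x) == q x]].

Lemma orthP (s : {perm A}) :
  reflect ((forall x y, s (x + y) = s x + s y) /\ (forall x, q (s x) = q x))
          (s \in orth).
Proof.
rewrite inE; apply: (iffP andP).
  case=> /forallP sD /forallP sq; split=> [x y|x]; last exact/eqP.
  by have /forallP/(_ y)/eqP := sD x.
case=> sD sq; split; apply/forallP=> x; last by rewrite sq.
by apply/forallP=> y; rewrite sD.
Qed.

Fact orth_group_set : group_set orth.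
Proof.
apply/group_setP; split=> [|s t /orthP[sD sq] /orthP[tD tq]].
  by apply/orthP; split=> *; rewrite !perm1.
by apply/orthP; split=> *; rewrite !permM ?sD ?tD ?tq ?sq.
Qed.

Canonical orth_group := Group orth_group_set.

End OrthogonalGroup.

Definition gauss (R : realType) (A : finZmodType) (q : A -> QZ)
    (Gam : {group {perm A}}) : R[i] :=
  \sum_(x in orbit_transversal 'P Gam [set: A])
     \sum_(y in orbit 'P Gam x) eQZ R (bil q x y).

Lemma bil_orth (A : finZmodType) (q : A -> QZ) (s : {perm A}) (x y : A) :
  s \in orth q -> bil q (s x) (s y) = bil q x y.
Proof. by case/orthP=> sD sq; rewrite /bil -sD !sq. Qed.

Lemma gauss_orbit_repr (R : realType) (A : finZmodType) (q : A -> QZ)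
    (Gam : {group {perm A}}) (x x' : A) :
  Gam \subset orth q -> x' \in orbit 'P Gam x ->
  \sum_(y in orbit 'P Gam x') eQZ R (bil q x' y)
  = \sum_(y in orbit 'P Gam x) eQZ R (bil q x y).
Proof.
move=> sG /orbitP[s sGam <-]; have -> : orbit 'P Gam ('P%act x s) = orbit 'P Gam x.
  by apply/eqP; rewrite orbit_eq_mem mem_orbit.
rewrite (reindex_inj (@perm_inj _ s)) /=; apply: eq_big => [y|y _].
  by have := orbit_actr 'P x y sGam; rewrite /= apermE.
by rewrite bil_orth // (subsetP sG).
Qed.

(* The p-adic integers, as the inverse limit of the rings Z/p^n;
   padic_res a n is the least nonnegative residue of a modulo p^n. *)
Record padic_int (p : nat) := PadicInt {
  padic_res :> nat -> nat;
  padic_compat : forall n, padic_res n = (padic_res n.+1 %% p ^ n)%N }.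

Definition padic_unit (p : nat) (a : padic_int p) : Prop :=
  exists b : padic_int p, forall n, (a n * b n = 1 %[mod p ^ n])%N.

(* The embedding of Z/n, n > 1, into Q/Z sending 1 to 1/n. *)
Definition ZnQZ (n : nat) (z : 'Z_n) : QZ := toQZ ((z : nat)%:R / n%:R).

(* Meant for p an odd prime and k > 0, so that 2 is a unit of 'Z_(p ^ k); the
   bilinear form is then a x y / p^k, see bil_Aform. *)
Definition Aform (p k : nat) (a : padic_int p) : 'Z_(p ^ k) -> QZ :=
  fun x => ZnQZ (2%:R^-1 * ((a k)%:R * x * x)).

Arguments Aform {p} k a x.

HB.instance Definition _ (A1 A2 : finZmodType) :=
  GRing.Zmodule.on (A1 * A2)%type.

Definition orthogonal_sum (A1 A2 : finZmodType) (q1 : A1 -> QZ) (q2 : A2 -> QZ) :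
  (A1 * A2)%type -> QZ := fun x => q1 x.1 + q2 x.2.

Definition legendre (p : nat) (x : 'F_p) : int :=
  if x == 0 then 0 else if [exists y, y ^+ 2 == x] then 1 else - 1.

(* A choice of coordinates A ~ F_p^m, i.e., of an F_p-basis of A. *)
Definition coordinates (p m : nat) (A : finZmodType)
  (f : {additive 'rV['F_p]_m -> A}) : Prop := bijective f.

Definition elementary_form (p m : nat) (A : finZmodType) (q : A -> QZ) : Prop :=
  finite_quadratic_form q /\
  exists f : {additive 'rV['F_p]_m -> A}, coordinates f.

(* The inverse of the isomorphism F_p -> (1/p)Z/Z, c |-> c/p; meaningful only
   on the p-torsion of Q/Z. *)
Definition QZtoFp (p : nat) (z : QZ) : 'F_p := (Num.floor (p%:R * QZrepr z))%:~R.

Definition gram (p m : nat) (A : finZmodType) (q : A -> QZ)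
    (f : {additive 'rV['F_p]_m -> A}) : 'M['F_p]_m :=
  \matrix_(i, j) QZtoFp p (bil q (f (delta_mx 0 i)) (f (delta_mx 0 j))).

(* d represents the square class d(A). *)
Definition is_disc (p m : nat) (A : finZmodType) (q : A -> QZ) (d : 'F_p) :=
  exists f : {additive 'rV['F_p]_m -> A}, coordinates f /\ d = \det (gram q f).

Definition isotropic (A : finZmodType) (q : A -> QZ) (x : A) : Prop :=
  bil q x x = 0.

Definition has_isotropic (A : finZmodType) (q : A -> QZ) : Prop :=
  exists x : A, x <> 0 /\ isotropic q x.



Lemma cos_sinD2pi_int (R : realType) (x : R) (n : int) :
  cos (x + 2 * pi * n%:~R) = cos x /\ sin (x + 2 * pi * n%:~R) = sin x.
Proof.
have H m y : cos (y + 2 * pi * m%:R) = cos y :> R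
          /\ sin (y + 2 * pi * m%:R) = sin y :> R.
  elim: m y => [|m IH] y; first by rewrite mulr0 addr0.
  rewrite -[m.+1%:R]natr1 mulrDr addrA mulr1 [2 * pi]mulr_natl cosD2pi sinD2pi.
  by rewrite -mulr_natl; exact: IH.
case: n => m; first exact: H.
rewrite NegzE mulrNz mulrN.
by have [<- <-] := H m.+1 (x - 2 * pi * m.+1%:~R); rewrite subrK.
Qed.

Lemma eQZ_toQZ (R : realType) (x : rat) :
  eQZ R (toQZ x) = cos (2 * pi * ratr x) +i* sin (2 * pi * ratr x).
Proof.
have : toQZ (QZrepr (toQZ x)) == toQZ x by rewrite QZreprK.
rewrite toQZ_eq => /intrP[n /eqP]; rewrite subr_eq => /eqP xn.
rewrite /eQZ xn addrC rmorphD /= ratr_int mulrDr.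
by have [-> ->] := cos_sinD2pi_int (2 * pi * ratr x : R) n.
Qed.

Lemma QZtoFp_toQZ (p : nat) (n : int) : prime p ->
  QZtoFp p (toQZ (n%:~R / p%:R)) = n%:~R.
Proof.
move=> p_pr; have p0 : (p%:R : rat) != 0 by rewrite pnatr_eq0 -lt0n prime_gt0.
set x := n%:~R / p%:R.
have : toQZ (QZrepr (toQZ x)) == toQZ x by rewrite QZreprK.
rewrite toQZ_eq => /intrP[m /eqP]; rewrite subr_eq => /eqP xm.
rewrite /QZtoFp xm mulrDr /x mulrCA divff // mulr1.
have -> : p%:R * m%:~R + n%:~R = (p%:Z * m + n)%:~R :> rat by rewrite rmorphD rmorphM.
rewrite intrKfloor rmorphD rmorphM /=.
have -> : (p%:~R : 'F_p) = 0 by rewrite -[p%:~R]/(p%:R) pchar_Fp_0.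
by rewrite mul0r add0r.
Qed.

Section ZnQZTheory.
Variables (n : nat).
Hypothesis n_gt1 : (1 < n)%N.

Lemma ZnQZ_nat (m : nat) : ZnQZ (m%:R : 'Z_n) = toQZ (m%:R / n%:R).
Proof.
have n0 : (n%:R : rat) != 0 by rewrite pnatr_eq0 -lt0n ltnW.
apply/eqP; rewrite toQZ_eq val_Zp_nat // {2}(divn_eq m n) natrD mulrDl natrM.
by rewrite mulfK // opprD addrCA subrr addr0 rpredN natr_int.
Qed.

Lemma ZnQZD (x y : 'Z_n) : ZnQZ (x + y) = ZnQZ x + ZnQZ y.
Proof.
rewrite -[x]natr_Zp -[y]natr_Zp -natrD !ZnQZ_nat.
by rewrite -toQZD -mulrDl natrD.
Qed.

Lemma ZnQZ_inj (x : 'Z_n) : ZnQZ x = 0 -> x = 0.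
Proof.
have n0 : (n%:R : rat) != 0 by rewrite pnatr_eq0 -lt0n ltnW.
have -> : 0 = toQZ 0 by apply: esym; apply: (@addIr _ (toQZ 0)); rewrite -toQZD !add0r.
move/eqP; rewrite toQZ_eq subr0 => /intrP[m xm].
have xn : (x < n)%N by rewrite -{2}(Zp_cast n_gt1).
apply: val_inj => /=.
have {}xm : (x : nat)%:R = m%:~R * n%:R :> rat by rewrite -xm mulfVK.
have {}xm : (x : nat)%:Z = m * n%:Z by apply: (@intr_inj rat); rewrite rmorphM.
have := congr1 absz xm; rewrite abszM !absz_nat => xE.
by case: (absz m) xE => [|j] xE; [rewrite xE|move: xn; rewrite xE mulSn ltnNge leq_addr].
Qed.
End ZnQZTheory.

Lemma ZnQZMn n (n_gt1 : (1 < n)%N) (x : 'Z_n) m : ZnQZ (x *+ m) = ZnQZ x *+ m.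
Proof.
elim: m => [|m IH]; last by rewrite !mulrS ZnQZD // IH.
rewrite !mulr0n; apply: (@addIr _ (ZnQZ (0 : 'Z_n))).
by rewrite -ZnQZD // addr0 add0r.
Qed.

Lemma padic_unit_coprime p k (a : padic_int p) :
  padic_unit a -> coprime (p ^ k) (a k).
Proof.
case=> b /(_ k) ab; rewrite coprime_sym.
have : coprime (a k * b k) (p ^ k) by rewrite -coprime_modl ab coprime_modl coprime1n.
by rewrite coprimeMl => /andP[].
Qed.

Section CyclicForm.
Variables (p k : nat) (a : padic_int p).
Hypotheses (p_pr : prime p) (p_gt2 : (2 < p)%N) (k_gt0 : (0 < k)%N).

Let pk_gt1 : (1 < p ^ k)%N.
Proof. by rewrite -(expn0 p) ltn_exp2l // ltnW // prime_gt1. Qed.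

Lemma bil_Aform (x y : 'Z_(p ^ k)) :
  bil (Aform k a) x y = ZnQZ ((a k)%:R * x * y).
Proof.
have u2 : (2%:R : 'Z_(p ^ k)) \is a GRing.unit.
  rewrite unitZpE // coprimeXl // prime_coprime // gtnNdvd //.
rewrite /bil /Aform; set c := (a k)%:R; set h := 2%:R^-1.
have -> : h * (c * (x + y) * (x + y))
  = (h * (c * x * x) + h * (c * y * y)) + c * x * y.
  have -> : c * (x + y) * (x + y) = c * x * x + c * y * y + 2%:R * (c * x * y).
    by ring.
  by rewrite !mulrDr [h * (2%:R * _)]mulrA mulVr // mul1r.
by rewrite !ZnQZD // -addrA -opprD addrAC subrr add0r.
Qed.

Lemma Aform_fqf : padic_unit a -> finite_quadratic_form (Aform k a).
Proof.
move=> ua; split=> [z x|x y|x y z|x x0].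
- have -> : Aform k a (x *~ z) = Aform k a (x *+ `|z|%N).
    rewrite /Aform; case: z => // m; rewrite NegzE mulrNz /=; congr ZnQZ.
    by congr (_ * _); rewrite -!mulrA mulrNN.
  rewrite -[z ^+ 2]gez0_abs ?sqr_ge0 // abszX -pmulrn /Aform -ZnQZMn //.
  by rewrite !mulrnAr mulrnAl mulrnAr -mulrnA mulnn.
- by rewrite !bil_Aform mulrAC.
- by rewrite !bil_Aform -ZnQZD // mulrDr mulrDl.
have := x0 1; rewrite bil_Aform mulr1 => /(ZnQZ_inj pk_gt1) /eqP.
rewrite mulrI_eq0 => [/eqP //|]; apply: mulrI.
by rewrite unitZpE // padic_unit_coprime.
Qed.

End CyclicForm.

Lemma orthogonal_sum_fqf (A1 A2 : finZmodType) (q1 : A1 -> QZ) (q2 : A2 -> QZ) :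
  finite_quadratic_form q1 -> finite_quadratic_form q2 ->
  finite_quadratic_form (orthogonal_sum q1 q2).
Proof.
move=> [z1 s1 b1 n1] [z2 s2 b2 n2].
have bE x y : bil (orthogonal_sum q1 q2) x y = bil q1 x.1 y.1 + bil q2 x.2 y.2.
  rewrite /bil /orthogonal_sum /= !opprD.
  move: (q1 _) (q1 _) (q1 _) (q2 _) (q2 _) (q2 _) => w v u w' v' u'.
  by rewrite [u + u' + _]addrACA [u - v + _ + _]addrACA.
have bl (A : finZmodType) (q : A -> QZ) x : finite_quadratic_form q ->
    bil q x 0 = 0.
  case=> _ s b _; rewrite s; apply: (@addIr _ (bil q 0 x)).
  by rewrite -b !add0r.
split=> [n x|x y|x y z|[x1 x2] x0].
- rewrite /orthogonal_sum.
  have -> : (x *~ n).1 = x.1 *~ n by case: n => n; rewrite ?NegzE ?mulrNz /= raddfMn.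
  have -> : (x *~ n).2 = x.2 *~ n by case: n => n; rewrite ?NegzE ?mulrNz /= raddfMn.
  by rewrite z1 z2 mulrzDl.
- by rewrite !bE s1 s2.
- by rewrite !bE b1 b2 /= addrACA.
congr pair; [apply: n1 => y; have := x0 (y, 0) | apply: n2 => y; have := x0 (0, y)];
  rewrite bE /= bl ?addr0 ?add0r //; by split.
Qed.

(* Main.v *)
Require Import Defs.
From HB Require Import structures.
From mathcomp Require Import all_boot all_order all_fingroup all_algebra.
From mathcomp Require Import complex.
From mathcomp Require Import reals trigo.
From mathcomp Require Import finfield cyclic zify ring lra.

Set Implicit Arguments.
Unset Strict Implicit.
Unset Printing Implicit Defensive.

Import Order.TTheory GRing.Theory Num.Theory.

Local Open Scope ring_scope.
Local Open Scope complex_scope.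

(** Averaging over the orthogonal group turns the equivariant Gauss sum into
    |O(A)|^-1 times the sum of e((x, s x)) over x in A and s in O(A).

    For a cyclic form O(A) = {1, -1}, and the sum is a classical quadratic Gauss
    sum modulo p^k, which reduces to k <= 1.  Its sign for p = 1 mod 4 is found as
    by Gauss: were the sum T(zeta) of the (j/p) zeta^j equal to minus the product
    of the 2 sin (pi k / p), the p-th cyclotomic polynomial would divide an integer
    polynomial whose reduction mod p vanishes at 1 only to order (p - 1) / 2.

    For an elementary form, reflections show that O(A) is transitive on nonzero
    vectors of given norm c.  Detecting the norm by additive characters and
    completing the square, the orbit sums add up over c to the sum of
    G(t) = sum_y e(t (y, y)) over the t with (2 t)^2 = -1, and G(t) is computed by
    diagonalization.  For the anisotropic plane there is no orbit for c = 0 apart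
    from {0}, which accounts for the different value.

    For the mixed sum, scaling x by 1 + p^(k-1) t cancels the contribution of the
    vectors whose first coordinate is a unit; on the others O(A) acts through
    O(A_1) x O(A_2) up to an error orthogonal to x, so the average factors. *)

(** * The Legendre symbol and Euler's criterion *)

Section Legendre.
Variable p : nat.
Hypotheses (p_prime : prime p) (p_gt2 : (2 < p)%N).
Local Notation F := 'F_p.

Lemma Fp_two_neq0 : (2%:R : F) != 0.
Proof. by rewrite -(dvdn_pcharf (pchar_Fp p_prime)) gtnNdvd. Qed.

Lemma odd_prime_half : (p = (p.-1)./2.*2.+1)%N.
Proof.
by have [p2|op] := even_prime p_prime; lia.
Qed.

Lemma Fp_fermat (x : F) : x != 0 -> x ^+ p.-1 = 1.
Proof.
move=> x0; apply: (mulfI x0); rewrite -exprS prednK ?prime_gt0 // mulr1.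
by have := expf_card x; rewrite card_Fp.
Qed.

(** Write x = z^i with z a generator of the multiplicative group and h = (p - 1) / 2. Then z^(i h) =
    1 forces 2 h to divide i h, so i is even and z^(i / 2) is a square root. *)
Lemma Fp_square_of_half_power (x : F) : x ^+ (p.-1)./2 = 1 -> exists y, y ^+ 2 = x.
Proof.
have ph := odd_prime_half; set h := (p.-1)./2 in ph *.
have h0 : (0 < h)%N by lia.
have hp : p.-1 = h.*2 by rewrite {1}ph.
move=> xh; have x0 : x != 0.
  by apply: contra_eq_neq xh => ->; rewrite expr0n gtn_eqF // eq_sym oner_neq0.
have /hasP[z _ prz] : has (p.-1).-primitive_root [seq x <- enum F | x != 0].
  apply: has_prim_root; rewrite ?hp ?double_gt0 //.
  - apply/allP=> u; rewrite mem_filter => /andP[u0 _].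
    by rewrite -hp; apply/unity_rootP/Fp_fermat.
  - by rewrite filter_uniq ?enum_uniq.
  - by have := cardC1 (0 : F); rewrite cardE card_Fp // -hp enumT => <-.
have /(prim_rootP prz)[i xi] : x ^+ p.-1 = 1 by exact: Fp_fermat.
exists (z ^+ (i./2)); rewrite -exprM xi; congr (_ ^+ _).
move: xh; rewrite xi -exprM => /eqP; rewrite -(prim_order_dvd prz).
rewrite [X in (X %| _)%N](_ : _ = (2 * h)%N); last by lia.
by rewrite dvdn_pmul2r // dvdn2 => oi; rewrite muln2 even_halfK.
Qed.

(** The power squares to 1 by Fermat, so it is 1 or -1. Squares give 1, and conversely the value 1
    yields a square root by [Fp_square_of_half_power]. *)
Lemma euler_criterion (x : F) : (legendre x)%:~R = x ^+ (p.-1)./2.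
Proof.
have ph := odd_prime_half; have h0 : (0 < (p.-1)./2)%N by lia.
have hp : p.-1 = ((p.-1)./2 * 2)%N by lia.
rewrite /legendre; have [->|x0] := eqVneq x 0; first by rewrite expr0n gtn_eqF.
have xx : (x ^+ (p.-1)./2) ^+ 2 = 1 by rewrite -exprM -hp Fp_fermat.
case: ifPn => [/existsP[y /eqP yx]|ns].
  rewrite -yx -exprM mulnC -hp Fp_fermat //.
  by apply: contraNneq x0 => y0; rewrite -yx y0 expr0n.
move/eqP: xx; rewrite sqrf_eq1 => /orP[/eqP x1|/eqP ->]; last by [].
by case/negP: ns; apply/existsP; have [y <-] := Fp_square_of_half_power x1; exists y.
Qed.

Lemma legendre_values (x : F) : legendre x = 0 \/ legendre x = 1 \/ legendre x = -1.
Proof. by rewrite /legendre; case: ifP => _; [left|case: ifP => _; right; [left|right]]. Qed.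

(** Since p > 2, the values 0, 1 and -1 stay distinct modulo p. This lifts identities proved in F_p
    by Euler's criterion to integer-valued symbols. *)
Lemma sign_inj_Fp (i j : int) : i = 0 \/ i = 1 \/ i = -1 -> j = 0 \/ j = 1 \/ j = -1 ->
  i%:~R = j%:~R :> F -> i = j.
Proof.
have t0 := Fp_two_neq0; have o0 : (1 : F) != 0 by exact: oner_neq0.
move=> [|[]] -> [|[]] -> // /eqP.
- by rewrite mulrNz eq_sym oppr_eq0 (negPf o0).
- by rewrite mulrNz -subr_eq0 opprK (negPf t0).
- by rewrite mulrNz oppr_eq0 (negPf o0).
- by rewrite mulrNz eq_sym -subr_eq0 opprK (negPf t0).
Qed.

Lemma legendreM (x y : F) : legendre (x * y) = legendre x * legendre y.
Proof.
apply: sign_inj_Fp; first exact: legendre_values.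
  have [->|[->|->]] := legendre_values x; have [->|[->|->]] := legendre_values y;
  by [left|right; left|right; right].
by rewrite rmorphM /= !euler_criterion exprMn.
Qed.

Lemma legendre1 : legendre (1 : F) = 1.
Proof.
rewrite /legendre oner_eq0; case: existsP => // -[].
by exists 1; rewrite expr1n.
Qed.

Lemma legendre_sqr (x : F) : x != 0 -> legendre (x ^+ 2) = 1.
Proof.
move=> x0; rewrite /legendre expf_eq0 (negPf x0) andbF.
by case: existsP => // -[]; exists x.
Qed.

Lemma legendre_sq1 (x : F) : x != 0 -> legendre x ^+ 2 = 1.
Proof. by move=> x0; rewrite expr2 -legendreM -expr2 legendre_sqr. Qed.

Lemma legendre_prod (I : finType) (f : I -> F) :
  legendre (\prod_i f i) = \prod_i legendre (f i).
Proof. exact: (big_morph _ legendreM legendre1). Qed.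

Lemma legendreN1 : legendre (-1 : F) = (-1) ^+ (p.-1)./2.
Proof.
apply: sign_inj_Fp; first exact: legendre_values.
  by rewrite -signr_odd; case: (odd _); [right; right|right; left].
by rewrite euler_criterion rmorphXn /= mulrNz.
Qed.

Lemma card_sqrt (z : F) : (#|[pred x | x ^+ 2 == z]|%:R : int) = 1 + legendre z.
Proof.
rewrite /legendre; have [->|z0] := eqVneq z 0.
  rewrite addr0 (@eq_card1 _ 0) // => x; rewrite !inE /=.
  by rewrite expf_eq0.
case: ifPn => [/existsP[y /eqP yz]|ns]; last first.
  rewrite subrr eq_card0 // => x; apply/negbTE/negP; rewrite !inE => xz.
  by case/negP: ns; apply/existsP; exists x.
have y0 : y != 0 by apply: contraNneq z0 => y0; rewrite -yz y0 expr0n.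
have yN : y != - y.
  by rewrite -subr_eq0 opprK -mulr2n -mulr_natl mulf_eq0 negb_or Fp_two_neq0.
rewrite (eq_card (_ : _ =i [set y; - y])) ?cards2 ?yN // => x.
by rewrite !inE -yz eqf_sqr.
Qed.

End Legendre.

(** * The exponential character of Q/Z *)

Section Exponential.
Variable R : realType.
Local Notation e := (eQZ R).

Lemma toQZ0 : toQZ 0 = 0.
Proof. by apply: (@addIr _ (toQZ 0)); rewrite -toQZD !add0r. Qed.

Lemma toQZMn (x : rat) n : toQZ (x *+ n) = toQZ x *+ n.
Proof. by elim: n => [|n IH]; rewrite ?mulr0n ?toQZ0 // !mulrS toQZD IH. Qed.

Lemma toQZN (x : rat) : toQZ (- x) = - toQZ x.
Proof. by apply: (@addIr _ (toQZ x)); rewrite -toQZD !addNr toQZ0. Qed.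

Lemma toQZ_int (x : rat) : x \is a Num.int -> toQZ x = 0.
Proof. by move=> xi; apply/eqP; rewrite -toQZ0 toQZ_eq subr0. Qed.

Lemma eQZ0 : e 0 = 1.
Proof. by rewrite -toQZ0 eQZ_toQZ rmorph0 mulr0 cos0 sin0. Qed.

Lemma eQZD x y : e (x + y) = e x * e y.
Proof.
rewrite -[x]QZreprK -[y]QZreprK -toQZD !eQZ_toQZ rmorphD mulrDr cosD sinD /=.
by simpc; congr (_ +i* _); rewrite addrC.
Qed.

Lemma eQZMn x n : e (x *+ n) = e x ^+ n.
Proof. by elim: n => [|n IH]; rewrite ?eQZ0 // mulrS eQZD IH exprS. Qed.

Lemma QZ_frac (z : QZ) : exists2 r : rat, 0 <= r < 1 & z = toQZ r.
Proof.
exists (QZrepr z - (Num.floor (QZrepr z))%:~R).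
  have /andP[h1 h2] := floor_itv (QZrepr z).
  by rewrite subr_ge0 h1 ltrBlDr -[1]/(1%:~R) -rmorphD /= addrC.
by rewrite toQZD toQZN (toQZ_int (intr_int _ _)) oppr0 addr0 QZreprK.
Qed.

(** For a representative 0 < r < 1, sin (pi r) > 0, so cos (2 pi r) = cos^2 (pi r) - sin^2 (pi r) <
    1. *)
Lemma eQZ_eq1 z : (e z == 1) = (z == 0).
Proof.
have [r /andP[r0 r1] ->] := QZ_frac z; have [->|rn0] := eqVneq r 0.
  by rewrite toQZ0 eQZ0 !eqxx.
rewrite eQZ_toQZ eq_complex /=.
have rp : 0 < r by rewrite lt_def rn0.
have sp : 0 < sin (pi * ratr r) :> R.
  apply: sin_gt0_pi; rewrite mulr_gt0 ?pi_gt0 ?ltr0q //=.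
  by rewrite -[X in _ < X]mulr1 ltr_pM2l ?pi_gt0 // -(rmorph1 (@ratr R)) ltr_rat.
have -> : 2 * pi * ratr r = (pi * ratr r) *+ 2 :> R by ring.
have -> : (cos (pi * ratr r *+ 2) == 1 :> R) = false.
  apply/negbTE; rewrite lt_eqF // mulr2n cosD -!expr2.
  by have := cos2Dsin2 (pi * ratr r : R); have := exprn_gt0 2 sp; lra.
rewrite /= -toQZ0 toQZ_eq subr0; apply/esym/negbTE.
apply/intrP => -[m rm]; move: rp r1; rewrite rm ltr0z -[1]/(1%:~R) ltr_int.
by move=> ? ?; lia.
Qed.

(** A geometric sum whose ratio [e z] is an n-th root of unity, different from 1 unless z = 0. *)
Lemma sum_eQZ_mulrn (z : QZ) n : z *+ n = 0 ->
  \sum_(t < n) e (z *+ t) = if z == 0 then n%:R else 0.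
Proof.
move=> zn; have [->|z0] := eqVneq z 0.
  under eq_bigr do rewrite mul0rn eQZ0.
  by rewrite sumr_const card_ord.
have e1 : e z - 1 != 0 by rewrite subr_eq0 eQZ_eq1.
apply: (mulfI e1); rewrite mulr0; under eq_bigr do rewrite eQZMn.
by rewrite -subrX1 -eQZMn zn eQZ0 subrr.
Qed.

End Exponential.

(** * Equivariant Gauss sums as averages over the group *)

Section GaussAverage.
Variables (R : realType) (A : finZmodType) (q : A -> QZ).
Local Notation e := (eQZ R).

(** The fibre of s |-> s x over a point of the orbit is a right coset of the stabilizer of x. *)
Lemma sum_orbit (T : finType) (G : {group {perm T}}) (f : T -> R[i]) (x : T) :
  \sum_(s in G) f (s x) = #|'C_G[x | 'P]%g|%:R * \sum_(y in orbit 'P G x) f y.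
Proof.
rewrite (partition_big (fun s : {perm T} => s x) (fun y => y \in orbit 'P G x)) /=; last first.
  by move=> s sG; apply/orbitP; exists s.
rewrite mulr_sumr; apply: eq_bigr => y /orbitP[s sG /= <-].
rewrite apermE; under eq_bigr => t /andP[_ /eqP ->] do [].
rewrite sumr_const mulr_natl -(card_rcoset 'C_G[x | 'P]%g s) -amove_act ?subsetT //.
by congr (_ *+ _); apply: eq_card => t; rewrite !inE /= !apermE.
Qed.

Lemma orbit_average (T : finType) (G : {group {perm T}}) (f : T -> R[i]) (x : T) :
  #|G|%:R^-1 * \sum_(s in G) f (s x)
  = #|orbit 'P G x|%:R^-1 * \sum_(y in orbit 'P G x) f y.
Proof.
rewrite sum_orbit -(card_orbit_stab 'P G x) natrM invfM -mulrA; congr (_ * _).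
rewrite mulKf // pnatr_eq0 -lt0n; exact: cardG_gt0.
Qed.

(** By [sum_orbit], x contributes |Stab x| times its orbit sum. Both factors are constant along an
    orbit, so a whole orbit contributes |Stab x| |Gx| = |G| times the sum at its representative. *)
Lemma gauss_average (G : {group {perm A}}) : G \subset orth q ->
  gauss R q G = #|G|%:R^-1 * \sum_x \sum_(s in G) e (bil q x (s x)).
Proof.
move=> sG; have acts : [acts G, on [set: A] | 'P].
  by apply/actsP=> s sGG x; rewrite !inE.
have [_ _ inj ex] := orbit_transversalP acts.
pose T x := \sum_(y in orbit 'P G x) e (bil q x y).
rewrite /gauss; set X := orbit_transversal _ _ _ in inj ex *.
have G0 : #|G|%:R != 0 :> R[i] by rewrite pnatr_eq0 -lt0n cardG_gt0.
apply: (mulfI G0); rewrite mulrA divff // mul1r.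
under [RHS]eq_bigr => x _ do rewrite (sum_orbit _ (fun y => e (bil q x y))) -/(T x).
have /(set_partition_big _) sumP := orbit_partition acts.
transitivity (\sum_(x in [set: A]) #|'C_G[x | 'P]%g|%:R * T x); last first.
  by apply: eq_bigl => x; rewrite in_setT.
rewrite sumP /=.
have -> : orbit 'P G @: [set: A] = orbit 'P G @: X.
  apply/setP=> O; apply/imsetP/imsetP => -[x xX ->]; last by exists x.
  have [s sGG sX] := ex x (in_setT x); exists ('P%act x s) => //.
  by apply/eqP; rewrite eq_sym orbit_eq_mem mem_orbit.
rewrite [RHS]big_imset /=; last first.
  move=> x y xX yX /eqP; rewrite eq_sym orbit_eq_mem inj //.
  by move/eqP.
rewrite mulr_sumr; apply: eq_bigr => x _.
have -> : \sum_(y in orbit 'P G x) #|'C_G[y | 'P]%g|%:R * T y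
   = \sum_(y in orbit 'P G x) #|'C_G[x | 'P]%g|%:R * T x.
  apply: eq_bigr => y yx; rewrite /T (gauss_orbit_repr _ sG yx); congr (_%:R * _).
  have := card_orbit_stab 'P G y; rewrite -(card_orbit_stab 'P G x).
  have -> : orbit 'P G y = orbit 'P G x by apply/eqP; rewrite orbit_eq_mem.
  move/eqP; rewrite eqn_pmul2l; first by move/eqP.
  by rewrite card_gt0; apply/set0Pn; exists x; exact: orbit_refl.
by rewrite sumr_const -[RHS]mulr_natl mulrA -natrM card_orbit_stab.
Qed.

Lemma sum_orthMr (s : {perm A}) (f : {perm A} -> R[i]) : s \in orth q ->
  \sum_(t in orth q) f (s * t)%g = \sum_(t in orth q) f t.
Proof.
move=> sO; rewrite [RHS](reindex_inj (mulgI s)); apply: eq_bigl => t.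
by rewrite [RHS](@groupMl _ (orth_group q)).
Qed.

End GaussAverage.

(** * The p-th cyclotomic polynomial and its reduction modulo p *)

Section CyclotomicReduction.
Variable p : nat.
Hypotheses (p_prime : prime p).

(** The p-th cyclotomic polynomial 1 + X + ... + X^(p-1), over any ring so that it can be moved
    between the integers, the rationals, F_p and the complex numbers. *)
Definition allone_poly (S : nzRingType) : {poly S} := \poly_(i < p) 1.

Lemma allone_polyE (S : nzRingType) : allone_poly S = \sum_(i < p) 'X^i.
Proof. by rewrite /allone_poly poly_def; apply: eq_bigr => i _; rewrite scale1r. Qed.

Lemma allone_polyM (S : comNzRingType) : ('X - 1) * allone_poly S = 'X^p - 1.
Proof. by rewrite allone_polyE -subrX1. Qed.

Lemma size_allone_poly (S : nzRingType) : size (allone_poly S) = p.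
Proof. by rewrite size_poly_eq ?oner_neq0. Qed.

Lemma allone_poly_monic (S : nzRingType) : allone_poly S \is monic.
Proof.
rewrite monicE lead_coefE size_allone_poly coef_poly.
by rewrite prednK ?prime_gt0 // leqnn.
Qed.

Lemma map_allone_poly (S T : nzRingType) (f : {rmorphism S -> T}) :
  map_poly f (allone_poly S) = allone_poly T.
Proof.
apply/polyP=> i; rewrite coef_map !coef_poly.
by case: ifP => _; [exact: rmorph1|exact: rmorph0].
Qed.

(** By Frobenius X^p - 1 = (X - 1)^p in characteristic p; cancel one factor X - 1. *)
Lemma Fp_allone_poly : allone_poly 'F_p = ('X - 1) ^+ p.-1.
Proof.
have X0 : ('X - 1 : {poly 'F_p}) != 0 by rewrite polyXsubC_eq0.
apply: (mulfI X0); rewrite allone_polyM -exprS prednK ?prime_gt0 //.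
have chP : p \in [pchar {poly 'F_p}] by rewrite pchar_poly pchar_Fp.
by have := pFrobenius_autB_comm chP (commr1 'X); rewrite !pFrobenius_autE expr1n.
Qed.

Lemma allone_poly_comp_coef i : ((allone_poly int) \Po ('X + 1))`_i = 'C(p, i.+1)%:R.
Proof.
have : 'X * ((allone_poly int) \Po ('X + 1)) = ('X + 1) ^+ p - 1.
  have := congr1 (fun r => r \Po ('X + 1)) (allone_polyM int).
  by rewrite /= comp_polyM !comp_polyB comp_polyX comp_Xn_poly -polyC1 comp_polyC addrK.
move/(congr1 (fun r : {poly int} => r`_i.+1)); rewrite coefXM /= => ->.
rewrite coefB coef1 subr0 addrC exprDn coef_sum.
under eq_bigr => j _ do rewrite expr1n mul1r coefMn coefXn.
have [ip|pi] := ltnP i p; last first.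
  rewrite bin_small ?ltnS // big1 // => j _.
  by rewrite gtn_eqF ?mul0rn // (leq_trans (ltn_ord j)).
rewrite (bigD1 (Ordinal (ip : i.+1 < p.+1)%N)) //= eqxx big1 ?addr0 // => j.
by rewrite -val_eqE /= eq_sym => /negPf ->; rewrite mul0rn.
Qed.

(** Eisenstein's criterion at p after the substitution of X + 1 for X: the coefficients become the
    binomials C(p, i + 1), with constant term p. Substituting X - 1 then transports divisibility
    back. *)
Lemma allone_poly_irreducible : irreducible_poly (map_poly intr (allone_poly int) : {poly rat}).
Proof.
have p1 := prime_gt1 p_prime; have p0 := prime_gt0 p_prime.
set f := allone_poly int; set g := f \Po ('X + 1).
have sg : size g = p by rewrite size_comp_poly2 ?size_XaddC // size_allone_poly.
have : irreducible_poly g.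
  apply: (@eisenstein_crit p) => //; rewrite ?sg.
  - by rewrite neq_ltn p1 orbT.
  - rewrite lead_coefE sg allone_poly_comp_coef prednK // binn.
    by rewrite dvdzE /= dvdn1 neq_ltn p1 orbT.
  - rewrite allone_poly_comp_coef bin1 natz dvdzE !absz_nat.
    by rewrite gtnNdvd // -[(p ^+ 2)%R]/(p * p)%N; nia.
  - move=> i ip; rewrite allone_poly_comp_coef natz dvdzE /=.
    by rewrite prime_dvd_bin //=; lia.
move/irreducible_rat_int; rewrite /g map_comp_poly /= => -[sz irr].
have Xa : map_poly intr ('X + 1) = 'X + 1 :> {poly rat}.
  by rewrite rmorphD /= map_polyX rmorph1.
rewrite Xa in sz irr; split.
  by move: sz; rewrite size_comp_poly2 ?size_XaddC.
move=> d d1 df.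
have : d \Po ('X + 1) %= map_poly intr f \Po ('X + 1).
  by apply: irr; rewrite ?dvdp_comp_poly // size_comp_poly2 ?size_XaddC.
move/andP=> [h1 h2]; apply/andP; split=> //.
have back r : (r \Po ('X + 1)) \Po ('X - 1) = r :> {poly rat}.
  by rewrite -comp_polyA comp_polyD comp_polyX comp_polyC subrK comp_polyXr.
by have := dvdp_comp_poly ('X - 1) h2; rewrite !back.
Qed.

(** The cyclotomic polynomial divides f over the integers, because it is irreducible over the
    rationals and shares the root z with f. Modulo p it becomes (X - 1)^(p - 1). *)
Lemma prime_root_vanishing (L : numFieldType) (z : L) (f : {poly int}) :
  p.-primitive_root z -> root (map_poly intr f) z ->
  exists h : {poly 'F_p}, map_poly intr f = ('X - 1) ^+ p.-1 * h.
Proof.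
move=> prz fz; have p1 := prime_gt1 p_prime; have p0 := prime_gt0 p_prime.
have mon := allone_poly_monic int.
have Phiz : root (allone_poly L) z.
  have z1 : z - 1 != 0.
    rewrite subr_eq0 -[z]expr1 -(prim_order_dvd prz) dvdn1.
    by rewrite neq_ltn p1 orbT.
  rewrite /root -(mulrI_eq0 _ (mulfI z1)).
  have := congr1 (fun r => r.[z]) (allone_polyM L).
  rewrite !hornerE => ->; rewrite (prim_expr_order prz) subrr //.
have fE := Pdiv.RingMonic.rdivp_eq mon f.
(* The divisor is monic, so Euclidean division stays within integer polynomials. *)
set r := Pdiv.Ring.rmodp _ _ in fE; set h := Pdiv.Ring.rdivp _ _ in fE.
have r0 : r = 0.
  have rz : root (map_poly intr r) z.
    move: fz; rewrite fE rmorphD rmorphM /= map_allone_poly /root !hornerE.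
    by rewrite (eqP Phiz) mulr0 add0r.
  have sr : (size r < p)%N.
    by rewrite -(size_allone_poly int) Pdiv.Ring.ltn_rmodp monic_neq0.
  apply/eqP; apply: contraTT sr => rn0; rewrite -leqNgt.
  have rq0 : (map_poly intr r : {poly rat}) != 0.
    by rewrite map_poly_eq0_id0 ?intr_eq0 ?lead_coef_eq0.
  have szr : size (map_poly intr r : {poly rat}) = size r.
    by rewrite size_map_poly_id0 ?intr_eq0 ?lead_coef_eq0.
  have [_ irr] := allone_poly_irreducible; rewrite map_allone_poly in irr.
  (* The common root z excludes coprimality. By irreducibility the cyclotomic polynomial, of size p,
     then divides r, which bounds the size of r below by p. *)
  have : ~~ coprimep (allone_poly rat) (map_poly intr r).
    apply/negP; rewrite -(coprimep_map (@ratr L)) /= => cop.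
    have := coprimep_root cop (x := z); rewrite map_allone_poly /=.
    rewrite -map_poly_comp (eq_map_poly (g := intr)); last by move=> i /=; rewrite ratr_int.
    by rewrite (eqP rz) eqxx => /(_ Phiz).
  rewrite /coprimep => /irr /(_ (dvdp_gcdl _ _)) eqg.
  rewrite -szr -(size_allone_poly rat) dvdp_leq //.
  by rewrite -(eqp_dvdl _ eqg) dvdp_gcdr.
exists (map_poly intr h); rewrite fE r0 addr0 rmorphM /= map_allone_poly.
by rewrite Fp_allone_poly mulrC.
Qed.

End CyclotomicReduction.

(** * Additive characters of F_p and the quadratic Gauss sum up to sign *)

Section FpCharacter.
Variables (R : realType) (p : nat).
Hypotheses (p_prime : prime p) (p_gt2 : (2 < p)%N).
Local Notation F := 'F_p.

(** The embedding c |-> c / p; ['F_p] unfolds to ['Z_(pdiv p)], which explains the modulus. *)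
Definition FpQZ (c : F) : QZ := @ZnQZ (pdiv p) c.

Let pdiv_gt1 : (1 < pdiv p)%N.
Proof. by rewrite pdiv_id // prime_gt1. Qed.

Lemma FpQZ_nat (m : nat) : FpQZ m%:R = toQZ (m%:R / p%:R).
Proof. by rewrite /FpQZ (ZnQZ_nat pdiv_gt1) pdiv_id. Qed.

Lemma FpQZD (x y : F) : FpQZ (x + y) = FpQZ x + FpQZ y.
Proof. exact: (ZnQZD pdiv_gt1). Qed.

Lemma FpQZ0 : FpQZ 0 = 0.
Proof. by apply: (@addIr _ (FpQZ 0)); rewrite -FpQZD !add0r. Qed.

Lemma FpQZ_eq0 (x : F) : (FpQZ x == 0) = (x == 0).
Proof.
apply/eqP/eqP => [|->]; last exact: FpQZ0.
exact: (ZnQZ_inj pdiv_gt1).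
Qed.

Lemma FpQZN (x : F) : FpQZ (- x) = - FpQZ x.
Proof. by apply: (@addIr _ (FpQZ x)); rewrite -FpQZD // !addNr FpQZ0. Qed.

Lemma FpQZ_inj : injective FpQZ.
Proof.
move=> x y /eqP; rewrite -subr_eq0 -FpQZN -FpQZD // FpQZ_eq0 // subr_eq0.
by move/eqP.
Qed.

Lemma FpQZ_int (n : int) : FpQZ (n%:~R : F) = toQZ (n%:~R / p%:R).
Proof.
case: n => n; first exact: FpQZ_nat.
by rewrite NegzE !mulrNz FpQZN FpQZ_nat // mulNr toQZN.
Qed.

(** The representative of a p-torsion class is n / p with n an integer, so [QZtoFp] loses nothing on
    such classes. *)
Lemma QZtoFpK (z : QZ) : z *+ p = 0 -> FpQZ (QZtoFp p z) = z.
Proof.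
have p0 : (p%:R : rat) != 0 by rewrite pnatr_eq0 -lt0n prime_gt0.
rewrite -[z]QZreprK -toQZMn => /eqP; rewrite -toQZ0 toQZ_eq subr0 => /intrP[n rn].
have -> : QZrepr z = n%:~R / p%:R by rewrite -rn -[X in X / _]mulr_natr mulfK.
by rewrite QZtoFp_toQZ // FpQZ_int.
Qed.

Definition chi (c : F) : R[i] := eQZ R (FpQZ c).

Lemma chiD x y : chi (x + y) = chi x * chi y.
Proof. by rewrite /chi FpQZD eQZD. Qed.

Lemma chi0 : chi 0 = 1.
Proof. by rewrite /chi FpQZ0 eQZ0. Qed.

Lemma chi_eq1 x : (chi x == 1) = (x == 0).
Proof. by rewrite /chi eQZ_eq1 FpQZ_eq0. Qed.

(** Translating c by 1 multiplies the sum by [chi a], which differs from 1 when a is nonzero. *)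
Lemma sum_chi (a : F) : \sum_c chi (a * c) = if a == 0 then p%:R else 0.
Proof.
have [->|a0] := eqVneq a 0.
  under eq_bigr do rewrite mul0r chi0.
  by rewrite sumr_const card_Fp.
have e1 : chi a - 1 != 0 by rewrite subr_eq0 chi_eq1.
apply: (mulfI e1); rewrite mulr0 mulrBl mul1r; apply/eqP; rewrite subr_eq0.
rewrite [X in _ == X](reindex_inj (addrI 1)) mulr_sumr; apply/eqP.
by apply: eq_bigr => c _; rewrite mulrDr mulr1 chiD.
Qed.

Definition gaussF : R[i] := \sum_x chi (x ^+ 2).

Lemma sum_chi_sqr (a : F) : \sum_x chi (a * x ^+ 2) =
  \sum_z (1 + legendre z)%:~R * chi (a * z).
Proof.
rewrite (partition_big (fun x => x ^+ 2) predT) //=; apply: eq_bigr => z _.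
under eq_bigr => x /eqP -> do [].
rewrite sumr_const -card_sqrt // -[LHS]mulr_natl; congr (_ * _).
by rewrite natz -pmulrn; congr (_%:R); apply: eq_card => x; rewrite !inE.
Qed.

Lemma sum_legendre_chi (a : F) : a != 0 ->
  \sum_x chi (a * x ^+ 2) = \sum_z (legendre z)%:~R * chi (a * z).
Proof.
move=> a0; rewrite sum_chi_sqr.
under eq_bigr do rewrite rmorphD /= mulrDl mul1r.
by rewrite big_split /= sum_chi (negPf a0) add0r.
Qed.

Lemma sum_chi_sqrM (a : F) : a != 0 ->
  \sum_x chi (a * x ^+ 2) = (legendre a)%:~R * gaussF.
Proof.
move=> a0; rewrite sum_legendre_chi // /gaussF.
under [in RHS]eq_bigr do rewrite -[_ ^+ 2]mul1r.
rewrite sum_legendre_chi ?oner_neq0 // [in RHS](reindex_inj (mulfI a0)) mulr_sumr.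
apply: eq_bigr => z _; rewrite mul1r legendreM // mulrA -rmorphM /= mulrA.
by rewrite -expr2 legendre_sq1 // mul1r.
Qed.

(** Multiply the sum by its twist at -1, which is (-1/p) times itself. With x = u + y the exponent
    x^2 - y^2 becomes u^2 + 2 u y, and summing over y leaves only u = 0, with value p. *)
Lemma gaussF_sqr : gaussF ^+ 2 = (legendre (-1 : F))%:~R * p%:R.
Proof.
have N0 : (-1 : F) != 0 by rewrite oppr_eq0 oner_neq0.
have : gaussF * \sum_y chi (-1 * y ^+ 2) = p%:R.
  rewrite mulr_sumr; under eq_bigr => y _ do
    rewrite /gaussF (reindex_inj (addIr y)) /= mulr_suml.
  rewrite exchange_big /= (bigD1 (0 : F)) //= [X in _ + X]big1 => [|u u0].
    under eq_bigr => y _ do rewrite add0r mulN1r -chiD subrr chi0.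
    by rewrite addr0 sumr_const card_Fp.
  have -> : \sum_y chi ((u + y) ^+ 2) * chi (-1 * y ^+ 2)
     = chi (u ^+ 2) * \sum_y chi ((2%:R * u) * y).
    rewrite mulr_sumr; apply: eq_bigr => y _; rewrite -!chiD; congr chi.
    by ring.
  by rewrite sum_chi mulf_eq0 (negPf (Fp_two_neq0 _ _)) ?(negPf u0) ?mulr0.
rewrite sum_chi_sqrM // => <-; set l := _%:~R.
have ll : l * l = 1 by rewrite /l -rmorphM /= -expr2 legendre_sq1.
by rewrite [RHS]mulrCA [l * (l * _)]mulrA ll mul1r expr2.
Qed.

End FpCharacter.

(** * Orders of vanishing at 1 of polynomials modulo p *)

Section PowerSumPoly.
Variable p : nat.
Hypotheses (p_prime : prime p).
Local Notation F := 'F_p.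

Lemma dvd_XsubC_sub_pow (a b : nat) :
  exists V : {poly F}, 'X^a - 'X^b = ('X - 1) * V /\ V.[1] = a%:R - b%:R.
Proof.
exists (\sum_(i < a) 'X^i - \sum_(i < b) 'X^i); split.
  by rewrite mulrBr -!subrX1 opprB addrA subrK.
rewrite !hornerE !horner_sum.
by do 2![under eq_bigr do rewrite hornerXn expr1n; rewrite sumr_const card_ord].
Qed.

(* Applying X d/dX to (X - 1)^(p - 1) lowers the order of vanishing at 1 by one. *)
Lemma power_sum_poly_factor n : (n < p)%N ->
  exists U : {poly F}, \sum_(j < p) ((j%:R : F) ^+ n) *: 'X^j = ('X - 1) ^+ (p.-1 - n) * U
    /\ U.[1] = (-1) ^+ n * (n`!)%:R.
Proof.
elim: n => [|n IH] np.
  exists 1; split; last by rewrite hornerC expr0 mul1r.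
  rewrite subn0 mulr1 -(Fp_allone_poly p_prime) allone_polyE.
  by apply: eq_bigr => i _; rewrite expr0 scale1r.
have [U [E U1]] := IH (ltnW np).
exists ('X * (U *+ (p.-1 - n) + ('X - 1) * U^`())); split.
  have -> : \sum_(j < p) ((j%:R : F) ^+ n.+1) *: 'X^j
     = 'X * (\sum_(j < p) ((j%:R : F) ^+ n) *: 'X^j)^`().
    rewrite raddf_sum mulr_sumr; apply: eq_bigr => -[[|j] jp] _ /=.
      by rewrite expr0n scale0r expr0 alg_polyC derivC mulr0.
    rewrite derivZ derivXn /= -scalerAr mulrnAr -exprS -scaler_nat scalerA exprSr.
    by [].
  have dX : ('X - 1 : {poly F})^`() = 1 by rewrite -polyC1 derivXsubC.
  rewrite E derivM deriv_exp dX.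
  have -> : (p.-1 - n = (p.-1 - n.+1).+1)%N by lia.
  by rewrite /= exprS; ring.
rewrite !hornerE subrr mul0r addr0 hornerMn U1 exprS factS natrM -[LHS]mulr_natr.
(* The exponent brought down by the derivative is p - 1 - n, that is -(n + 1) modulo p; it turns
   (-1)^n n! into the next value. *)
have -> : ((p.-1 - n)%:R : F) = - n.+1%:R.
  apply/eqP; rewrite -addr_eq0 -natrD.
  have -> : (p.-1 - n + n.+1 = p)%N by lia.
  by rewrite pchar_Fp_0.
by ring.
Qed.

End PowerSumPoly.

(** * The sign of the quadratic Gauss sum for p = 1 mod 4 *)

Section GaussSign.
Variables (R : realType) (p : nat).
Hypotheses (p_prime : prime p) (p_gt2 : (2 < p)%N).
Local Notation F := 'F_p.
Local Notation n := (p.-1)./2.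
Local Notation E r := (eQZ R (toQZ r)).

Let p0 : (p%:R : rat) != 0.
Proof. by rewrite pnatr_eq0 -lt0n prime_gt0. Qed.

Lemma chi_nat (j : nat) : chi R (j%:R : F) = E (j%:R / p%:R).
Proof. by rewrite /chi FpQZ_nat. Qed.

Lemma chi_nat_exp (j : nat) : chi R (j%:R : F) = chi R (1 : F) ^+ j.
Proof.
elim: j => [|j IH]; first by rewrite expr0 chi0.
by rewrite -natr1 chiD // IH exprSr.
Qed.

Lemma chi1_prim : p.-primitive_root (chi R (1 : F)).
Proof.
have p1 := prime_gt1 p_prime.
have zp : chi R (1 : F) ^+ p = 1 by rewrite -chi_nat_exp pchar_Fp_0 ?chi0.
have [m pm mp] := prim_order_exists (prime_gt0 p_prime) zp.
case/primeP: p_prime => _ /(_ m mp) /orP[/eqP m1|/eqP mE]; last by move: pm; rewrite mE.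
move: pm; rewrite m1 => /prim_expr_order /eqP; by rewrite expr1 chi_eq1.
Qed.

Lemma E_half (j : nat) : E (j%:R / 2%:R) = (-1) ^+ j.
Proof.
have -> : j%:R / 2%:R = (2%:R^-1 : rat) *+ j by rewrite mulr_natl.
rewrite toQZMn eQZMn; congr (_ ^+ _); rewrite eQZ_toQZ fmorphV /= ratr_nat.
by rewrite mulrAC divff ?pnatr_eq0 // mul1r cospi sinpi; simpc.
Qed.

(** The factors are the absolute values of 1 - exp (2 i pi j / p) for 1 <= j <= (p - 1) / 2, with j
    = k + 1. The product is the positive square root of p. *)
Definition sine_product : R := \prod_(k < n) (2%:R * sin (pi * (k.+1%:R / p%:R))).

Lemma sine_product_gt0 : 0 < sine_product.
Proof.
have ph := odd_prime_half p_prime p_gt2.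
apply: prodr_gt0 => k _; apply: mulr_gt0; first by rewrite ltr0n.
have pR : (0 : R) < p%:R by rewrite ltr0n prime_gt0.
apply: sin_gt0_pi; rewrite mulr_gt0 ?pi_gt0 ?divr_gt0 ?ltr0n ?(prime_gt0 p_prime) //=.
rewrite -[X in _ < X]mulr1 ltr_pM2l ?pi_gt0 // ltr_pdivrMr // mul1r ltr_nat.
by have := ltn_ord k; lia.
Qed.

Lemma E_sub (r : rat) : E r - E (- r) = (2%:R * sin (2%:R * pi * ratr r))%:C * 'i%C.
Proof.
rewrite !eQZ_toQZ rmorphN mulrN cosN sinN; simpc; congr (_ +i* _).
by rewrite -[LHS]/(sin (2%:R * pi * ratr r) + sin (2%:R * pi * ratr r)) -mulr2n [RHS]mulr_natl.
Qed.

(** Evaluating the factorization of 1 + X + ... + X^(p-1) at 1 gives p as the product of all 1 -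
    z^i. Pairing i with p - i produces the factors 4 sin^2 (pi i / p). *)
Lemma sine_product_sqr : sine_product ^+ 2 = p%:R.
Proof.
have ph := odd_prime_half p_prime p_gt2.
set z := chi R (1 : F).
have prodz : \prod_(1 <= i < p) (1 - z ^+ i) = p%:R.
  have := factor_Xn_sub_1 chi1_prim; rewrite -/z -(allone_polyM p).
  rewrite big_ltn ?prime_gt0 // expr0 => /mulfI H.
  have {}H := H (negbT (polyXsubC_eq0 _)).
  have := congr1 (fun r => r.[1]) H; rewrite /= horner_prod allone_polyE horner_sum.
  under eq_bigr do rewrite hornerXsubC.
  move=> ->; under eq_bigr do rewrite hornerXn expr1n.
  by rewrite sumr_const card_ord.
apply: (@complexI R); rewrite rmorph_nat -prodz.
rewrite (big_cat_nat (n := n.+1)) //=; last by lia.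
have -> : \prod_(n.+1 <= i < p) (1 - z ^+ i) = \prod_(1 <= i < n.+1) (1 - z ^+ (p - i)).
  rewrite -[n.+1 in LHS]addn1 addnC big_addn.
  rewrite big_nat_rev /=; apply: congr_big_nat => //; first by lia.
  by move=> i /andP[i1 i2]; congr (1 - z ^+ _); lia.
rewrite -big_split /= big_add1 big_mkord /= expr2 /sine_product rmorphM /= -rmorphM.
rewrite -big_split /= rmorph_prod; apply: eq_bigr => k _.
have kp : (k.+1 <= p)%N by have := ltn_ord k; lia.
set r : rat := k.+1%:R / p%:R.
have -> : z ^+ k.+1 = E r by rewrite -chi_nat_exp chi_nat.
have -> : z ^+ (p - k.+1) = E (- r).
  rewrite -chi_nat_exp chi_nat natrB // mulrBl divff //.
  by rewrite toQZD (toQZ_int (rpred1 _)) add0r.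
have -> : pi * (k.+1%:R / p%:R) = pi * ratr r :> R.
  by rewrite /r fmorph_div /= !ratr_nat.
rewrite !eQZ_toQZ rmorphN mulrN cosN sinN /=; simpc.
have -> : 2 * pi * ratr r = (pi * ratr r) *+ 2 :> R by ring.
rewrite cos_mulr2n sin_mulr2n; set c := cos _; set s := sin _.
have cs : c ^+ 2 + s ^+ 2 = 1 by rewrite cos2Dsin2.
have c2 : c ^+ 2 = 1 - s ^+ 2 by rewrite -cs addrK.
apply/eqP; rewrite eq_complex /=; apply/andP; split; apply/eqP; last by ring.
rewrite [X in _ = _ + X](_ : _ = (c ^+ 2 * s ^+ 2) *+ 4); last by ring.
by rewrite c2; ring.
Qed.

(* As n.+1 = (p + 1) / 2, the k-th factor takes the value 2 i sin (pi (k + 1) / p)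
   at exp (2 i pi / p). *)
Definition sine_poly : {poly int} :=
  (-1) ^+ n./2 * \prod_(k < n) ((-1) ^+ k.+1 * ('X^(k.+1 * n.+1) - 'X^(p.-1 * (k.+1 * n.+1)))).

Hypothesis p_mod4 : (p = 1 %[mod 4])%N.

Let nE : (n = (n./2).*2)%N.
Proof. by have := odd_prime_half p_prime p_gt2; lia. Qed.

Lemma sine_poly_eval :
  (map_poly intr sine_poly).[chi R (1 : F)] = sine_product%:C.
Proof.
have ph := odd_prime_half p_prime p_gt2.
rewrite /sine_poly rmorphM rmorphXn rmorphN1 rmorph_prod /= hornerM horner_exp.
rewrite hornerN hornerC horner_prod /sine_product rmorph_prod.
have -> : \prod_(k < n) (map_poly intr ((-1) ^+ k.+1 *
    ('X^(k.+1 * n.+1) - 'X^(p.-1 * (k.+1 * n.+1))))).[chi R (1 : F)] =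
    \prod_(k < n) ((2%:R * sin (pi * (k.+1%:R / p%:R)))%:C * 'i%C) :> R[i].
  apply: eq_bigr => k _.
  rewrite rmorphM rmorphXn rmorphN1 rmorphB /= !map_polyXn.
  rewrite hornerM horner_exp hornerN hornerC hornerD hornerN !hornerXn.
  rewrite -!chi_nat_exp !chi_nat; set j := k.+1.
  (* As n + 1 = (p + 1) / 2, the exponent splits into j / 2, which only gives the sign (-1)^j, and
     the half angle j / (2 p). *)
  have h1 : (j * n.+1)%:R / p%:R = j%:R / 2%:R + j%:R / (2%:R * p%:R) :> rat.
    have -> : (p%:R : rat) = 2%:R * n%:R + 1.
      by rewrite {1}ph -addn1 natrD -muln2 natrM mulrC.
    have q0 : 2%:R * n%:R + 1 != 0 :> rat.
      by rewrite -[1]/(1%:R) -natrM -natrD pnatr_eq0 addn1.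
    by rewrite natrM -natr1; field.
  (* Multiplication by p - 1 stands for the sign change of an exponent, keeping exponents
     natural. *)
  have h2 : (p.-1 * (j * n.+1))%:R / p%:R = (j * n.+1)%:R - (j * n.+1)%:R / p%:R :> rat.
    rewrite natrM; have -> : (p.-1%:R : rat) = p%:R - 1.
      by rewrite -subn1 natrB ?prime_gt0.
    by field.
  rewrite h2 toQZD (toQZ_int (natr_int _ _)) add0r h1 opprD !toQZD !eQZD.
  have -> : E (- (j%:R / 2%:R)) = E (j%:R / 2%:R).
    congr (eQZ R _); apply/eqP; rewrite toQZ_eq -opprD -mulrDl -natrD rpredN.
    by rewrite addnn -muln2 natrM mulfK ?pnatr_eq0 // natr_int.
  rewrite E_half -mulrBr E_sub mulrA -expr2 sqrr_sign mul1r.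
  congr ((2%:R * sin _)%:C * _).
  rewrite rmorphM fmorphV rmorphM /= !ratr_nat.
  by field; rewrite !pnatr_eq0 -lt0n prime_gt0.
rewrite big_split /= prodr_const card_ord mulrCA -[X in _ = X]mulr1; congr (_ * _).
(* As n is even, i^n = (-1)^(n / 2), which the leading sign of [sine_poly] cancels. *)
by rewrite [in 'i%C ^+ _]nE -mul2n exprM sqr_i -exprMn mulrNN mulr1 expr1n.
Qed.

(** Each factor contributes one X - 1, with cofactor value 2 k (n + 1) = k (p + 1) = k at 1 modulo
    p, up to sign. The signs (-1)^k multiply to (-1)^(n / 2), which the leading sign of [sine_poly]
    cancels, leaving n!. *)
Lemma sine_poly_factor : exists V : {poly F},
  map_poly intr sine_poly = ('X - 1) ^+ n * V /\ V.[1] = n`!%:R.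
Proof.
have ph := odd_prime_half p_prime p_gt2.
have step k : exists V : {poly F}, map_poly intr ('X^(k * n.+1) - 'X^(p.-1 * (k * n.+1)))
    = ('X - 1) * V /\ V.[1] = k%:R.
  have [V [EV V1]] := dvd_XsubC_sub_pow p (k * n.+1) (p.-1 * (k * n.+1)).
  exists V; split; first by rewrite rmorphB /= !map_polyXn.
  rewrite V1 natrM [(p.-1 * _)%:R]natrM.
  have p00 : (p%:R : F) = 0 by rewrite pchar_Fp_0.
  have -> : (p.-1%:R : F) = -1 by rewrite -subn1 natrB ?prime_gt0 // p00 sub0r.
  rewrite natrM mulN1r opprK -mulrDr -natrD addnn.
  rewrite (_ : (n.+1).*2 = p.+1); last by lia.
  by rewrite -natr1 p00 add0r mulr1.
have sgn m : \prod_(k < m.*2) (-1) ^+ k.+1 = (-1) ^+ m :> F.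
  elim: m => [|m IH]; first by rewrite big_ord0.
  rewrite doubleS !big_ord_recr /= IH -!mulrA -exprD -[X in _ * X]signr_odd.
  by rewrite oddD /= !odd_double [RHS]exprSr.
have prodV m : exists V : {poly F},
   map_poly intr (\prod_(k < m) ((-1) ^+ k.+1 * ('X^(k.+1 * n.+1) - 'X^(p.-1 * (k.+1 * n.+1)))))
   = ('X - 1) ^+ m * V /\ V.[1] = (\prod_(k < m) (-1) ^+ k.+1) * m`!%:R.
  elim: m => [|m [V [EV V1]]].
    by exists 1; rewrite !big_ord0 rmorph1 mulr1 hornerC mulr1.
  have [W [EW W1]] := step m.+1.
  exists (V * ((-1) ^+ m.+1 * W)); split.
    rewrite !big_ord_recr rmorphM /= EV rmorphM /= EW rmorphXn rmorphN1 /=.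
    rewrite [('X - 1) ^+ _.+1]exprSr -!mulrA; congr (_ * _).
    by rewrite [RHS]mulrCA; congr (_ * _); rewrite mulrCA.
  rewrite !hornerM V1 W1 horner_exp hornerN hornerC big_ord_recr /= factS natrM.
  by ring.
have [V [EV V1]] := prodV n.
exists ((-1) ^+ n./2 * V); split.
  by rewrite /sine_poly rmorphM /= EV rmorphXn rmorphN1 mulrCA.
rewrite hornerM V1 horner_exp hornerN hornerC mulrA; set f := n`!%:R.
by rewrite nE sgn -nE -expr2 sqrr_sign mul1r.
Qed.

Lemma gaussF_sign : gaussF R p = (Num.sqrt (p%:R : R))%:C.
Proof.
have ph := odd_prime_half p_prime p_gt2.
have n0 : (0 < n)%N by lia.
have g2 : gaussF R p ^+ 2 = p%:R.
  by rewrite gaussF_sqr // legendreN1 // nE -signr_odd odd_double mul1r.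
have -> : Num.sqrt (p%:R : R) = sine_product.
  by rewrite -sine_product_sqr sqrtr_sqr ger0_norm // ltW // sine_product_gt0.
have : gaussF R p ^+ 2 == sine_product%:C ^+ 2.
  by rewrite g2 -rmorphXn /= sine_product_sqr rmorph_nat.
(* Both squares are p, so only the opposite sign has to be excluded. *)
rewrite eqf_sqr => /orP[/eqP //|/eqP gN]; exfalso.
(* T takes the value of the Gauss sum at exp (2 i pi / p), while Euler's criterion makes its
   reduction modulo p the polynomial with coefficients j^n. *)
pose T : {poly int} := \sum_(j < p) (legendre (j%:R : F)) *: 'X^j.
have Tz : (map_poly intr T).[chi R (1 : F)] = gaussF R p.
  rewrite /T rmorph_sum horner_sum /=.
  have -> : gaussF R p = \sum_z (legendre z)%:~R * chi R (z : F).
    rewrite /gaussF; under eq_bigr do rewrite -[_ ^+ 2]mul1r.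
    rewrite sum_legendre_chi ?oner_neq0 //.
    by apply: eq_bigr => z _; rewrite mul1r.
  rewrite -(big_mkord predT (fun j => (map_poly intr ((legendre (j%:R : F)) *: 'X^j)).[chi R (1 : F)])).
  have {1}-> : p = (Zp_trunc (pdiv p)).+2 by rewrite Fp_cast.
  rewrite big_mkord; apply: eq_bigr => z _.
  by rewrite map_polyZ /= map_polyXn !hornerE -chi_nat_exp natr_Zp.
have rootz : root (map_poly intr (T + sine_poly)) (chi R (1 : F)).
  by rewrite /root rmorphD hornerD /= Tz sine_poly_eval gN addNr.
have [h Eh] := prime_root_vanishing p_prime chi1_prim rootz.
have [V [EV V1]] := sine_poly_factor.
have np : (n < p)%N by lia.
have [U [EU U1]] := power_sum_poly_factor p_prime np.
have ET : map_poly intr T = \sum_(j < p) ((j%:R : F) ^+ n) *: 'X^j.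
  rewrite /T rmorph_sum; apply: eq_bigr => j _.
  by rewrite /= map_polyZ /= map_polyXn euler_criterion.
move: Eh; rewrite rmorphD /= ET EU EV.
have -> : (p.-1 - n = n)%N by lia.
have p1E : p.-1 = (n + n)%N by lia.
have X0 : ('X - 1 : {poly F}) ^+ n != 0 by rewrite expf_neq0 ?polyXsubC_eq0.
(* Since p - 1 = 2 n, cancelling (X - 1)^n leaves U + V = (X - 1)^n h. At 1 this reads 2 n! = 0 in
   F_p, as n is even and positive, whereas n < p. *)
rewrite [in X in _ = X * h]p1E -mulrDr exprD -mulrA => /(mulfI X0).
move/(congr1 (fun r => r.[1])).
rewrite /= !hornerE U1 V1 subrr expr0n gtn_eqF // mul0r nE -signr_odd odd_double mul1r -nE.
move/eqP; rewrite -mulr2n -[X in X == _]mulr_natl mulf_eq0 (negPf (Fp_two_neq0 _ _)) //=.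
rewrite -(dvdn_pcharf (pchar_Fp p_prime)) => pdvd.
suff : forall m, (m < p)%N -> ~~ (p %| m`!)%N by move=> /(_ n np); rewrite pdvd.
elim=> [|m IH] mp; first by rewrite dvdn1 neq_ltn prime_gt1 ?orbT.
by rewrite factS Euclid_dvdM // negb_or IH ?(ltnW mp) // gtnNdvd.
Qed.

End GaussSign.

(** * The bilinear form and its isometries *)

Section Isometries.
Variables (A : finZmodType) (q : A -> QZ).
Hypothesis fqf : finite_quadratic_form q.

Lemma bilC x y : bil q x y = bil q y x.
Proof. by case: fqf. Qed.

Lemma bilDl x y z : bil q (x + y) z = bil q x z + bil q y z.
Proof. by case: fqf. Qed.

Lemma bilDr x y z : bil q z (x + y) = bil q z x + bil q z y.
Proof. by rewrite bilC bilDl ![bil q z _]bilC. Qed.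

Lemma bil0l x : bil q 0 x = 0.
Proof. by apply: (@addIr _ (bil q 0 x)); rewrite -bilDl !add0r. Qed.

Lemma bilNl x y : bil q (- x) y = - bil q x y.
Proof. by apply: (@addIr _ (bil q x y)); rewrite -bilDl !addNr bil0l. Qed.

Lemma bilMnl x y n : bil q (x *+ n) y = bil q x y *+ n.
Proof. by elim: n => [|n IH]; rewrite ?mulr0n ?bil0l // !mulrS bilDl IH. Qed.

Lemma bilMnr x y n : bil q x (y *+ n) = bil q x y *+ n.
Proof. by rewrite bilC bilMnl bilC. Qed.

Lemma bil_diag x : bil q x x = q x *+ 2.
Proof.
rewrite /bil; have [qM _ _ _] := fqf.
by rewrite -[x + x]/(x *~ 2) qM -[_ *~ _]/(q x *+ 4) -addrA -opprD -mulr2n -mulrnBr.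
Qed.

Lemma orth_Mn (s : {perm A}) x m :
  s \in orth q -> s (x *+ m) = s x *+ m.
Proof.
case/orthP=> sD _; elim: m => [|m IH]; last by rewrite !mulrS sD IH.
by rewrite !mulr0n; apply: (@addIr _ (s 0)); rewrite -sD !add0r.
Qed.

(** If f x = f y, then x - y is orthogonal to everything, so nondegeneracy makes f injective, hence
    a permutation of the finite group. *)
Lemma isometry_orth (f : A -> A) :
  (forall x y, f (x + y) = f x + f y) -> (forall x, q (f x) = q x) ->
  exists2 s : {perm A}, s \in orth q & forall x, s x = f x.
Proof.
move=> fD fq; have f0 : f 0 = 0 by apply: (@addIr _ (f 0)); rewrite -fD !add0r.
have fN x : f (- x) = - f x by apply: (@addIr _ (f x)); rewrite -fD !addNr f0.
have f_inj : injective f.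
  move=> x y fxy; apply/eqP; rewrite -subr_eq0; apply/eqP.
  have [_ _ _ nd] := fqf; apply: nd => z.
  have -> : bil q (x - y) z = bil q (f (x - y)) (f z) by rewrite /bil -fD !fq.
  by rewrite fD fN fxy subrr bil0l.
exists (perm f_inj); last by move=> x; rewrite permE.
by apply/orthP; split=> *; rewrite !permE ?fD ?fq.
Qed.

Lemma orth_opp : exists2 s : {perm A}, s \in orth q & forall x, s x = - x.
Proof.
apply: isometry_orth => [x y|x]; first by rewrite opprD.
by have [qM _ _ _] := fqf; have := qM (-1) x; rewrite mulrN1z => ->.
Qed.

End Isometries.

(** * The local ring Z/p^k *)

Lemma ZnQZ_injective n (n1 : (1 < n)%N) (x y : 'Z_n) : ZnQZ x = ZnQZ y -> x = y.
Proof.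
move=> xy; apply/eqP; rewrite -subr_eq0; apply/eqP/(ZnQZ_inj n1).
apply: (@addIr _ (ZnQZ y)); rewrite -(ZnQZD n1) subrK xy add0r //.
Qed.

Section LocalRing.
Variables (p k : nat).
Hypotheses (p_prime : prime p) (p_gt2 : (2 < p)%N) (k_gt0 : (0 < k)%N).
Local Notation Z := 'Z_(p ^ k).

Lemma Zpk_gt1 : (1 < p ^ k)%N.
Proof. by rewrite -(expn0 p) ltn_exp2l // prime_gt1. Qed.

Lemma Zpk_unit_nat (m : nat) : ((m%:R : Z) \is a GRing.unit) = ~~ (p %| m)%N.
Proof.
rewrite unitZpE ?Zpk_gt1 // -prime_coprime //.
by rewrite coprime_pexpl.
Qed.

Lemma Zpk_nonunitP (z : Z) : z \isn't a GRing.unit -> exists y, z = p%:R * y.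
Proof.
rewrite -{1}[z]natr_Zp Zpk_unit_nat negbK => /dvdnP[m zm].
by exists m%:R; rewrite -[z]natr_Zp zm mulrC natrM.
Qed.

Lemma Zpk_p_nonunit (y : Z) : p%:R * y \isn't a GRing.unit.
Proof. by rewrite -[y]natr_Zp -natrM Zpk_unit_nat dvdn_mulr. Qed.

Lemma Zpk_nonunitD (x y : Z) : x \isn't a GRing.unit -> y \isn't a GRing.unit ->
  x + y \isn't a GRing.unit.
Proof.
by move=> /Zpk_nonunitP[x' ->] /Zpk_nonunitP[y' ->]; rewrite -mulrDr Zpk_p_nonunit.
Qed.

Lemma Zpk_unitDl (x y : Z) : x \is a GRing.unit -> y \isn't a GRing.unit ->
  x + y \is a GRing.unit.
Proof.
move=> ux ny; apply: contraLR ux => nxy.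
by rewrite -[x](addrK y) Zpk_nonunitD // unitrN.
Qed.

Lemma Zpk_two_unit : (2%:R : Z) \is a GRing.unit.
Proof. by rewrite Zpk_unit_nat gtnNdvd. Qed.

(** Since 2 is a unit of this local ring, c - 1 or c + 1 is a unit and can be cancelled from r (c -
    1) (c + 1) = 0. The case r = 1 serves cyclic forms, the case r = p mixed sums. *)
Lemma Zpk_sqr_fix (r c : Z) : r * c ^+ 2 = r -> r * c = r \/ r * c = - r.
Proof.
move=> rc; have E : r * (c - 1) * (c + 1) = 0.
  by rewrite -mulrA -subr_sqr_1 mulrBr mulr1 rc subrr.
have [u|nu] := boolP (c + 1 \is a GRing.unit).
  left; apply/eqP; rewrite -subr_eq0 -{2}[r]mulr1 -mulrBr.
  by rewrite -(mulrK u (r * (c - 1))) E mul0r.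
right; have u : c - 1 \is a GRing.unit.
  have -> : c - 1 = - 2%:R + (c + 1) by ring.
  by rewrite Zpk_unitDl ?unitrN ?Zpk_two_unit.
apply/eqP; rewrite -addr_eq0 -{2}[r]mulr1 -mulrDr.
by rewrite -(mulrK u (r * (c + 1))) [r * _ * _]mulrAC E mul0r.
Qed.

End LocalRing.

(** * Classical quadratic Gauss sums modulo p^k *)

Section PrimePowerGaussSum.
Variables (R : realType) (p : nat).
Hypotheses (p_prime : prime p) (p_gt2 : (2 < p)%N).
Local Notation F := 'F_p.
Local Notation E r := (eQZ R (toQZ r)).

Definition ppgauss (k a : nat) : R[i] :=
  \sum_(0 <= x < p ^ k) E ((a * x ^ 2)%:R / (p ^ k)%:R).

Let p0 : (p%:R : rat) != 0.
Proof. by rewrite pnatr_eq0 -lt0n prime_gt0. Qed.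

Lemma big_nat_mul_shift (V : nmodType) (G : nat -> V) m n :
  \sum_(0 <= x < m * n) G x = \sum_(0 <= t < m) \sum_(0 <= i < n) G (t * n + i)%N.
Proof.
rewrite big_nat_mul; apply: eq_bigr => t _.
rewrite -{1}[(t * n)%N]add0n big_addn mulSn addnK.
by apply: eq_bigr => i _; rewrite addnC.
Qed.

(** Write x = t p^(k+1) + i. The term depends on t only through the character 2 a i t / p, so
    summing over t keeps the multiples i = p j of p, for which the exponent is a j^2 / p^k. *)
Lemma ppgaussSS k a : ~~ (p %| a)%N -> ppgauss k.+2 a = p%:R * ppgauss k a.
Proof.
move=> pa; rewrite /ppgauss {1}expnS big_nat_mul_shift exchange_big /=.
set P := (p ^ k.+1)%N.
have stepE t i : E ((a * (t * P + i) ^ 2)%:R / (p ^ k.+2)%:R)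
    = E ((a * i ^ 2)%:R / (p ^ k.+2)%:R) * eQZ R (toQZ ((2 * a * i)%:R / p%:R) *+ t).
  have -> : (a * (t * P + i) ^ 2)%:R / (p ^ k.+2)%:R =
     (a * i ^ 2)%:R / (p ^ k.+2)%:R + ((2 * a * i)%:R / p%:R) *+ t
      + (a * t ^ 2 * p ^ k)%:R :> rat.
    rewrite -[_ *+ t]mulr_natr /P !expnS.
    rewrite !natrM; rewrite !natrD !natrM.
    by field; rewrite p0 natrX expf_neq0.
  by rewrite !toQZD (toQZ_int (natr_int _ _)) addr0 eQZD toQZMn.
have inner i : \sum_(0 <= t < p) E ((a * (t * P + i) ^ 2)%:R / (p ^ k.+2)%:R)
   = if (p %| i)%N then p%:R * E ((a * i ^ 2)%:R / (p ^ k.+2)%:R) else 0.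
  under eq_bigr do rewrite stepE.
  rewrite -mulr_sumr big_mkord sum_eQZ_mulrn; last first.
    by rewrite -toQZMn -[_ *+ p]mulr_natr divfK // (toQZ_int (natr_int _ _)).
  rewrite -(FpQZ_nat p_prime (2 * a * i)) FpQZ_eq0 // -(dvdn_pcharf (pchar_Fp p_prime)).
  rewrite !Euclid_dvdM // (negPf pa) gtnNdvd //=.
  by case: ifP => _; rewrite ?mulr0 // mulrC.
under eq_bigr do rewrite inner.
rewrite /P expnSr big_nat_mul_shift mulr_sumr; apply: eq_bigr => j _.
rewrite big_ltn ?prime_gt0 // addn0 dvdn_mull // big_nat_cond big1 ?addr0 => [|r].
  congr (_ * E _); rewrite !expnS expn0 !natrM.
  by field; rewrite p0 natrX expf_neq0.
by case/andP=> /andP[r0 rp] _; rewrite dvdn_addr ?dvdn_mull // gtnNdvd.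
Qed.

Lemma ppgauss0 a : ppgauss 0 a = 1.
Proof. by rewrite /ppgauss expn0 big_nat1 exp0n // muln0 mul0r toQZ0 eQZ0. Qed.

Lemma ppgauss1 a : ~~ (p %| a)%N ->
  ppgauss 1 a = (legendre (a%:R : F))%:~R * gaussF R p.
Proof.
move=> pa; rewrite -sum_chi_sqrM -?(dvdn_pcharf (pchar_Fp p_prime)) //.
rewrite /ppgauss expn1 -[X in \sum_(0 <= x < X) _](Fp_cast p_prime) big_mkord.
apply: eq_bigr => x _; rewrite -[in RHS](natr_Zp x) -natrX -natrM chi_nat //.
Qed.

Lemma ppgauss_even j a : ~~ (p %| a)%N -> ppgauss j.*2 a = (p ^ j)%:R.
Proof.
move=> pa; elim: j => [|j IH]; first by rewrite ppgauss0.
by rewrite doubleS ppgaussSS // IH expnS natrM.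
Qed.

Lemma ppgauss_odd j a : ~~ (p %| a)%N ->
  ppgauss j.*2.+1 a = (p ^ j)%:R * ((legendre (a%:R : F))%:~R * gaussF R p).
Proof.
move=> pa; elim: j => [|j IH]; first by rewrite ppgauss1 // mul1r.
by rewrite doubleS ppgaussSS // IH expnS natrM -[RHS]mulrA.
Qed.

End PrimePowerGaussSum.

(** * Equivariant Gauss sums of cyclic forms *)

Section CyclicGauss.
Variables (R : realType) (p : nat).
Hypotheses (p_prime : prime p) (p_gt2 : (2 < p)%N).
Variables (k : nat) (a : padic_int p).
Hypotheses (k_gt0 : (0 < k)%N) (ua : padic_unit a).
Local Notation Z := 'Z_(p ^ k).
Local Notation q := (Aform k a).

Let n_gt1 : (1 < p ^ k)%N := Zpk_gt1 p_prime k_gt0.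
Let fqf : finite_quadratic_form q := Aform_fqf p_prime p_gt2 k_gt0 ua.

Lemma Aform_a_unit : ((a k)%:R : Z) \is a GRing.unit.
Proof. by rewrite unitZpE // padic_unit_coprime. Qed.

(** An automorphism is multiplication by its value at 1, and preservation of the form at 1 says that
    this value squares to 1. *)
Lemma orth_Aform (s : {perm Z}) : s \in orth q ->
  (forall x, s x = x) \/ (forall x, s x = - x).
Proof.
move=> sO; have sE x : s x = s 1 * x.
  by rewrite -{1}[x]natr_Zp (orth_Mn _ _ sO) -mulr_natr natr_Zp.
have c2 : s 1 ^+ 2 = 1.
  case/orthP: sO => _ /(_ 1); rewrite /Aform => /(ZnQZ_injective n_gt1).
  have u2 : (2%:R^-1 : Z) \is a GRing.unit by rewrite unitrV Zpk_two_unit.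
  move/(mulrI u2).
  rewrite -!mulrA => /(mulrI Aform_a_unit).
  by rewrite !mulr1 expr2.
have := Zpk_sqr_fix p_prime p_gt2 k_gt0 (r := 1) (c := s 1).
rewrite !mul1r => /(_ c2) [] c; [left|right] => x.
  by rewrite sE c mul1r.
by rewrite sE c mulN1r.
Qed.

Lemma sum_Zn (f : nat -> R[i]) :
  \sum_(x : Z) f x = \sum_(0 <= x < p ^ k) f x.
Proof. by rewrite -[X in \sum_(0 <= x < X) _](Zp_cast n_gt1) big_mkord. Qed.

Lemma sum_bil_Aform : \sum_x eQZ R (bil q x x) = ppgauss R p k (a k).
Proof.
rewrite /ppgauss -sum_Zn; apply: eq_bigr => x _.
by rewrite bil_Aform // -{1 2}[x]natr_Zp -!natrM ZnQZ_nat // -mulnA mulnn.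
Qed.

Lemma sum_bil_AformN : \sum_x eQZ R (bil q x (- x)) = ppgauss R p k (a k * (p ^ k).-1).
Proof.
rewrite /ppgauss -sum_Zn; apply: eq_bigr => x _.
have N1 : ((p ^ k).-1%:R : Z) = -1.
  by apply: (@addIr _ 1); rewrite natr1 prednK ?pchar_Zp ?addNr // ltnW.
rewrite bil_Aform // -mulN1r -N1 -{1 2}[x]natr_Zp -!natrM ZnQZ_nat //.
by rewrite -!mulnA [(x * _)%N]mulnCA mulnn.
Qed.

Lemma gauss_Aform : gauss R q (orth_group q) =
  (ppgauss R p k (a k) + ppgauss R p k (a k * (p ^ k).-1)) / 2%:R.
Proof.
rewrite gauss_average // exchange_big /=.
have [t tO tE] := orth_opp fqf.
set S := \sum_(s in _) _; set c := _ + _.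
(* Pairing s with its composite with -1 gives the contributions of 1 and -1 in some order, whatever
   the order of O(A). *)
have S2 : 2%:R * S = #|orth q|%:R * c.
  rewrite mulr_natl mulr2n {1}/S -(sum_orthMr (fun s : {perm Z} => \sum_x eQZ R (bil q x (s x))) tO).
  rewrite -big_split /= mulr_natl -sumr_const; apply: eq_bigr => s /orth_Aform[] sE.
    rewrite /c -sum_bil_Aform -sum_bil_AformN addrC; congr (_ + _);
    by apply: eq_bigr => x _; rewrite ?permM ?tE sE.
  rewrite /c -sum_bil_Aform -sum_bil_AformN; congr (_ + _);
  by apply: eq_bigr => x _; rewrite ?permM ?tE sE ?opprK.
have O0 : #|orth q|%:R != 0 :> R[i].
  by rewrite pnatr_eq0 -lt0n (cardG_gt0 (orth_group q)).
have t0 : 2%:R != 0 :> R[i] by rewrite pnatr_eq0.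
apply: (mulfI t0); rewrite mulrCA S2 mulrA mulVf // mul1r.
by rewrite [RHS]mulrCA divff // mulr1.
Qed.

Lemma padic_res_Fp : ((a k)%:R : 'F_p) = (a 1%N)%:R.
Proof.
case: k k_gt0 => // j _; elim: j => // j <-.
rewrite [a j.+1](padic_compat a) -[RHS](Fp_nat_mod p_prime).
by rewrite modn_dvdm ?Fp_nat_mod // expnS dvdn_mulr.
Qed.

Lemma padic_res_ndvd : ~~ (p %| a k)%N.
Proof. by have := Aform_a_unit; rewrite (Zpk_unit_nat p_prime k_gt0). Qed.

(** For even k both sums are p^(k / 2). For odd k they carry the Legendre symbols of a and -a, which
    are opposite when p = 3 mod 4 and equal when p = 1 mod 4. *)
Lemma gauss_Aform_mod4 :
  ((p ^ k = 3 %[mod 4])%N -> gauss R q (orth_group q) = 0) /\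
  ((p ^ k = 1 %[mod 4])%N ->
    gauss R q (orth_group q) = ((legendre ((a 1%N)%:R : 'F_p)) ^+ k)%:~R
          * (Num.sqrt (#|{: 'Z_(p ^ k)}|%:R : R))%:C).
Proof.
have ph := odd_prime_half p_prime p_gt2.
have pa := padic_res_ndvd; have aE := padic_res_Fp.
have a0 : ((a 1%N)%:R : 'F_p) != 0.
  by rewrite -aE -(dvdn_pcharf (pchar_Fp p_prime)).
have pk0 : ((p ^ k)%:R : 'F_p) = 0.
  by apply/eqP; rewrite -(dvdn_pcharf (pchar_Fp p_prime)) dvdn_exp.
have pN1 : ((p ^ k).-1%:R : 'F_p) = -1.
  by rewrite -subn1 natrB ?expn_gt0 ?prime_gt0 // pk0 sub0r.
have pa' : ~~ (p %| a k * (p ^ k).-1)%N.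
  rewrite Euclid_dvdM // negb_or pa (dvdn_pcharf (pchar_Fp p_prime)) pN1.
  by rewrite oppr_eq0 oner_neq0.
have halve (z : R[i]) : (z + z) / 2%:R = z.
  by rewrite -[z in z + z]mulr1 -mulrDr -[1 + 1]/(2%:R) mulfK ?pnatr_eq0.
have -> : #|{: Z}| = (p ^ k)%N by rewrite card_ord Zp_cast.
(* As p is odd, p^k modulo 4 is 1 for even k and p for odd k, so the case split is really on the
   parity of k. *)
have sq1 : (p ^ 2 = 1 %[mod 4])%N.
  have [m pm] : exists m, p = (m.*2.+1)%N by exists (p.-1)./2.
  have -> : (p ^ 2 = (m * m + m) * 4 + 1)%N by rewrite pm expnS expn1; lia.
  by rewrite modnMDl.
have sqe j : (p ^ j.*2 = 1 %[mod 4])%N.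
  by rewrite -mul2n expnM -modnXm sq1 modnXm exp1n.
have sqo j : (p ^ j.*2.+1 = p %[mod 4])%N.
  by rewrite expnSr -modnMml sqe modnMml mul1n.
have cE : ((a k * (p ^ k).-1)%:R : 'F_p) = -1 * (a 1%N)%:R.
  by rewrite natrM aE pN1 mulrC.
rewrite gauss_Aform; move: (a k) (a k * _)%N pa pa' aE cE => b c pb pc bE cE.
clear pk0 pN1 fqf n_gt1; have := odd_double_half k; case: (odd k) => /= <-; last first.
  rewrite add0n sqe !ppgauss_even // halve.
  split => // _; rewrite -mul2n exprM legendre_sq1 // expr1n mul1r.
  by rewrite [(2 * _)%N]mulnC expnM [(_ ^ 2)%:R]natrX sqrtr_sqr ger0_norm ?ler0n // rmorph_nat.
rewrite add1n sqo !ppgauss_odd // bE cE legendreM // legendreN1 //.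
split=> pm.
  have on : odd (p.-1)./2 by lia.
  by rewrite -signr_odd on mulN1r rmorphN /= mulNr mulrN subrr mul0r.
have on : odd (p.-1)./2 = false by lia.
rewrite -signr_odd on mul1r halve exprS -mul2n exprM legendre_sq1 // expr1n mulr1 gaussF_sign //.
rewrite mulrCA; congr (_ * _); rewrite -(rmorph_nat (real_complex R)) -rmorphM; congr (_%:C).
rewrite expnS [(2 * _)%N]mulnC expnM natrM sqrtrM ?ler0n // [(_ ^ 2)%:R]natrX sqrtr_sqr.
by rewrite ger0_norm ?ler0n // mulrC.
Qed.

End CyclicGauss.

(** * Cancellation by scaling with 1 + p^(k-1) t *)

Section ScalingCancellation.
Variables (R : realType) (p k : nat).
Hypotheses (p_prime : prime p) (p_gt2 : (2 < p)%N) (k_gt1 : (1 < k)%N).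
Variables (A : finZmodType) (q : A -> QZ).
Hypotheses (fqf : finite_quadratic_form q) (pkA : forall x : A, x *+ p ^ k = 0).
Local Notation lam t := (1 + p ^ k.-1 * t)%N.

(** A kernel element satisfies d = - p^(k-1) t d; iterating gives d = p^(2k-2) t^2 d = 0, since 2 k
    - 2 >= k. *)
Lemma mulrn_lam_inj t : injective (fun x : A => x *+ lam t).
Proof.
move=> x y /= /eqP; rewrite -subr_eq0 -mulrnBl => /eqP d0.
apply/eqP; rewrite -subr_eq0; set d := x - y in d0 *.
have cc : d *+ (p ^ k.-1 * t * (p ^ k.-1 * t)) = 0.
  rewrite mulnACA -expnD (_ : k.-1 + k.-1 = k + (k - 2))%N; last by lia.
  by rewrite expnD -!mulnA mulrnA pkA mul0rn.
have dc : d = - (d *+ (p ^ k.-1 * t)).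
  by apply/eqP; rewrite -addr_eq0 -{1}[d]mulr1n -mulrnDr d0.
by rewrite dc [X in X *+ _]dc mulNrn -mulrnA cc oppr0 oppr0.
Qed.

(* Replacing x by (1 + p^(k-1) t) x multiplies the summand by a nontrivial
   additive character of t. *)
Lemma scaling_cancellation (U : {set A}) (s : {perm A}) : s \in orth q ->
  (forall t x, (x *+ lam t \in U) = (x \in U)) ->
  (forall x, x \in U -> bil q x (s x) *+ p ^ k.-1 != 0) ->
  \sum_(x in U) eQZ R (bil q x (s x)) = 0.
Proof.
move=> sO Ulam Ub; set S := \sum_(x in U) _.
have p0 : p%:R != 0 :> R[i] by rewrite pnatr_eq0 -lt0n prime_gt0.
apply: (mulfI p0); rewrite mulr0.
have St t : S = \sum_(x in U) eQZ R (bil q x (s x) *+ (lam t * lam t)).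
  rewrite /S (reindex_inj (mulrn_lam_inj (t := t))) /=.
  apply: eq_big => [x|x _]; first by rewrite Ulam.
  by rewrite (orth_Mn _ _ sO) bilMnl // bilMnr // mulrnA.
have -> : p%:R * S = \sum_(t < p) S by rewrite sumr_const card_ord mulr_natl.
under eq_bigr => t _ do rewrite (St t).
rewrite exchange_big /= big1 // => x xU; set b := bil q x (s x).
have pb : b *+ p ^ k = 0 by rewrite -bilMnl // pkA bil0l.
have lamE t : b *+ (lam t * lam t) = b + (b *+ p ^ k.-1 *+ 2) *+ t.
  have -> : (lam t * lam t = 1 + p ^ k.-1 * 2 * t + p ^ k * (p ^ (k - 2) * (t * t)))%N.
    have -> : (p ^ k * (p ^ (k - 2) * (t * t)) = p ^ k.-1 * p ^ k.-1 * (t * t))%N.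
      by rewrite mulnA -!expnD; congr (p ^ _ * _)%N; lia.
    by ring.
  by rewrite !mulrnDr mulr1n [b *+ (p ^ k * _)]mulrnA pb mul0rn addr0 !mulrnA.
under eq_bigr => t _ do rewrite lamE eQZD.
have zp : b *+ p ^ k.-1 *+ p = 0 by rewrite -mulrnA -expnSr prednK // ltnW.
rewrite -mulr_sumr sum_eQZ_mulrn; last by rewrite mulrnAC zp mul0rn.
(* Here 2 z = 0 and p z = 0 with p odd, which forces z = 0 against [Ub]. *)
case: eqP => [z2|_]; last by rewrite mulr0.
have := Ub x xU; rewrite -/b; set z := b *+ _ in zp z2 *.
have := odd_prime_half p_prime p_gt2 => ph.
have : z *+ p = z by rewrite ph mulrS -mul2n mulrnA z2 mul0rn addr0.
by rewrite zp => <-; rewrite eqxx.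
Qed.

End ScalingCancellation.

(** * Orthogonal sums of a cyclic and an elementary form *)

Lemma elementary_torsion p m (A : finZmodType) (q : A -> QZ) : prime p ->
  elementary_form p m q -> forall x : A, x *+ p = 0.
Proof.
move=> p_prime [_ [f [g fg gf]]] x; rewrite -[x]gf -raddfMn.
have -> : g x *+ p = 0; last by rewrite raddf0.
by apply/matrixP=> i j; rewrite mulmxnE !mxE -mulr_natr pchar_Fp_0 ?mulr0.
Qed.

Lemma bil_orthogonal_sum (A1 A2 : finZmodType) (q1 : A1 -> QZ) (q2 : A2 -> QZ) x y :
  bil (orthogonal_sum q1 q2) x y = bil q1 x.1 y.1 + bil q2 x.2 y.2.
Proof.
rewrite /bil /orthogonal_sum /= !opprD.
move: (q1 _) (q1 _) (q1 _) (q2 _) (q2 _) (q2 _) => w v u w' v' u'.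
by rewrite [u + u' + _]addrACA [u - v + _ + _]addrACA.
Qed.

Lemma pair_mulrn (A1 A2 : finZmodType) (x : A1 * A2) n :
  x *+ n = (x.1 *+ n, x.2 *+ n).
Proof. by elim: n => [|n IH]; rewrite ?mulr0n // !mulrS IH. Qed.

Section MixedSum.
Variables (R : realType) (p : nat).
Hypotheses (p_prime : prime p) (p_gt2 : (2 < p)%N).
Variables (k : nat) (a : padic_int p).
Hypotheses (k_gt1 : (1 < k)%N) (ua : padic_unit a).
Variables (A2 : finZmodType) (q2 : A2 -> QZ).
Hypotheses (fqf2 : finite_quadratic_form q2) (pA2 : forall v : A2, v *+ p = 0).
Local Notation Z := 'Z_(p ^ k).
Local Notation q1 := (Aform k a).
Local Notation q := (orthogonal_sum q1 q2).
Local Notation e := (eQZ R).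

Let k_gt0 : (0 < k)%N := ltnW k_gt1.
Let n_gt1 : (1 < p ^ k)%N := Zpk_gt1 p_prime k_gt0.
Let fqf1 : finite_quadratic_form q1 := Aform_fqf p_prime p_gt2 k_gt0 ua.
Let fqf : finite_quadratic_form q := orthogonal_sum_fqf fqf1 fqf2.

Let pZ (u : Z) : u *+ p ^ k = 0.
Proof. by rewrite -mulr_natr pchar_Zp ?mulr0. Qed.

Let pA (x : Z * A2) : x *+ p ^ k = 0.
Proof.
have A2k (v : A2) : v *+ p ^ k = 0.
  by rewrite -(prednK k_gt0) expnS mulrnA pA2 mul0rn.
by rewrite pair_mulrn pZ A2k.
Qed.

Lemma Zpk_p_neq0 : (p%:R : Z) != 0.
Proof.
apply/eqP => /(congr1 val); rewrite /= val_Zp_nat // modn_small.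
  by move=> p0; have := prime_gt0 p_prime; rewrite p0.
by rewrite -{1}[p]expn1 ltn_exp2l // prime_gt1.
Qed.

Lemma ZnQZ0 : ZnQZ (0 : Z) = 0.
Proof. by have := ZnQZMn n_gt1 (0 : Z) 0; rewrite !mulr0n. Qed.

(** Multiplication by p^(k-1) kills exactly the multiples of p in Z/p^k, so units can be recognized
    from values of the form. *)
Lemma ZnQZ_unit_pk (u : Z) : (ZnQZ u *+ p ^ k.-1 == 0) = (u \isn't a GRing.unit).
Proof.
have E : p%:R * (p ^ k.-1)%:R = 0 :> Z by rewrite -natrM -expnS prednK ?pchar_Zp.
rewrite -ZnQZMn // -mulr_natr; apply/eqP/idP => [/(ZnQZ_inj n_gt1) u0|].
  apply/negP => uu; move/(congr1 (fun z => u^-1 * z)): u0.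
  rewrite mulrA mulVr // mul1r mulr0 => /(congr1 val) /=.
  rewrite val_Zp_nat // modn_small ?ltn_exp2l ?prime_gt1 ?prednK //.
  by move/eqP; rewrite expn_eq0 => /andP[/eqP p0]; have := prime_gt0 p_prime; rewrite p0.
by case/(Zpk_nonunitP p_prime k_gt0) => y ->; rewrite mulrAC E mul0r ZnQZ0.
Qed.

Lemma bil_sum_Mn x y n : (p %| n)%N -> bil q x y *+ n = bil q1 x.1 y.1 *+ n.
Proof.
case/dvdnP=> m ->; rewrite bil_orthogonal_sum [LHS]mulrnDl.
rewrite -(bilMnl fqf2) [x.2 *+ _](_ : _ = 0) ?bil0l ?addr0 //.
by rewrite mulnC mulrnA pA2 mul0rn.
Qed.

Lemma dvdn_pk1 : (p %| p ^ k.-1)%N.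
Proof. by rewrite dvdn_exp //; lia. Qed.

Lemma unit_lam t (u : Z) : (u *+ (1 + p ^ k.-1 * t) \is a GRing.unit) = (u \is a GRing.unit).
Proof.
rewrite -mulr_natr unitrMl // Zpk_unit_nat //.
rewrite dvdn_addl ?dvdn1 ?neq_ltn ?prime_gt1 ?orbT //.
by rewrite dvdn_mulr // dvdn_exp //; lia.
Qed.

(** As k > 1, multiplying the norm by p^(k-1) removes the elementary part and leaves a p^(k-1) x_1^2
    / p^k, which is nonzero exactly when x_1 is a unit. Isometries preserve it. *)
Lemma orth_unit (s : {perm Z * A2}) x : s \in orth q ->
  (s x).1 \is a GRing.unit = (x.1 \is a GRing.unit).
Proof.
move=> sO; have := bil_orth x x sO.
move/(congr1 (fun z => z *+ p ^ k.-1)); rewrite /= !bil_sum_Mn ?dvdn_pk1 // !bil_Aform //.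
move/(congr1 (fun z => z == 0)); rewrite !ZnQZ_unit_pk.
by rewrite !unitrM (Aform_a_unit p_prime k_gt0 ua) /= !andbb => /negb_inj.
Qed.

Lemma sum_unit_part (s : {perm Z * A2}) : s \in orth q ->
  \sum_(x in [set x : Z * A2 | x.1 \is a GRing.unit]) e (bil q x (s x)) = 0.
Proof.
move=> sO; apply: (scaling_cancellation _ p_prime p_gt2 k_gt1 fqf pA sO) => [t x|x].
  by rewrite !inE pair_mulrn unit_lam.
rewrite inE => ux; rewrite bil_sum_Mn ?dvdn_pk1 //.
by rewrite bil_Aform // ZnQZ_unit_pk negbK !unitrM orth_unit // ux (Aform_a_unit p_prime k_gt0 ua).
Qed.

Lemma sum_unit_part1 (s : {perm Z}) : s \in orth q1 ->
  \sum_(x in [set x : Z | x \is a GRing.unit]) e (bil q1 x (s x)) = 0.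
Proof.
move=> sO; apply: (scaling_cancellation _ p_prime p_gt2 k_gt1 fqf1 pZ sO) => [t x|x].
  by rewrite !inE unit_lam.
rewrite inE => ux; rewrite bil_Aform // ZnQZ_unit_pk negbK !unitrM ux.
rewrite (Aform_a_unit p_prime k_gt0 ua) /=.
by case: (orth_Aform p_prime p_gt2 k_gt0 ua sO) => ->; rewrite ?unitrN.
Qed.

(** Let c be the first coordinate of s (1, 0). For u divisible by p, s (u, 0) = (c u, 0), and c acts
    on multiples of p as 1 or -1; this gives s1. The second coordinate of s (0, v) gives s2, and its
    first coordinate is the error l. *)
Lemma orth_nonunit (s : {perm Z * A2}) : s \in orth q ->
  exists s1 s2, [/\ s1 \in orth q1, s2 \in orth q2 &
    forall u v, u \isn't a GRing.unit ->
      exists2 l : Z, l *+ p = 0 & s (u, v) = (s1 u + l, s2 v)].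
Proof.
move=> sO; have /orthP[sD sq] := sO.
have s0 : s 0 = 0 by apply: (@addIr _ (s 0)); rewrite -sD !add0r.
pose l v := (s (0, v)).1; pose g v := (s (0, v)).2.
have lp v : l v *+ p = 0.
  have : s ((0, v) *+ p) = 0 by rewrite pair_mulrn /= mul0rn pA2 s0.
  by rewrite (orth_Mn _ _ sO) pair_mulrn => -[].
(* As k > 1, p is nonzero in Z/p^k, so the p-torsion element [l v] is not a unit. Hence it is a
   multiple of p and its square vanishes, so that g preserves q2. *)
have ll v : l v * l v = 0.
  have nl : l v \isn't a GRing.unit.
    apply/negP => ul; have := lp v; rewrite -mulr_natr => /(congr1 (fun z => (l v)^-1 * z)).
    by rewrite mulrA mulVr // mul1r mulr0 => /eqP; rewrite (negPf Zpk_p_neq0).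
  have [y ly] := Zpk_nonunitP p_prime k_gt0 nl.
  by rewrite {2}ly mulrA mulr_natr lp mul0r.
have gD v w : g (v + w) = g v + g w.
  have -> : g (v + w) = (s ((0, v) + (0, w))).2.
    by rewrite /g; congr (s _).2; rewrite -[RHS]/(0 + 0, v + w) addr0.
  by rewrite sD.
have gq v : q2 (g v) = q2 v.
  have := sq (0, v); rewrite /orthogonal_sum /= /Aform -/(l v) -/(g v).
  by rewrite -[_ * l v * l v]mulrA ll !mulr0 ZnQZ0 !add0r.
have [s2 s2O s2E] := isometry_orth fqf2 gD gq.
set c := (s (1, 0)).1.
(* The norm of (1, 0), multiplied by p to discard the elementary coordinate. *)
have pc : p%:R * c ^+ 2 = p%:R.
  have := bil_orth (1, 0) (1, 0) sO.
  move/(congr1 (fun z => z *+ p)); rewrite !bil_sum_Mn // !bil_Aform // -!ZnQZMn // -/c.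
  move/(ZnQZ_injective n_gt1); rewrite -!mulrA -!mulrnAr.
  move/(mulrI (Aform_a_unit p_prime k_gt0 ua)).
  by move=> /= H; rewrite mulr_natl expr2 -mulrnAr H mul1r.
have [t tO tE] := orth_opp fqf1.
have [s1 s1O s1E] : exists2 s1, s1 \in orth q1 &
    forall u, u \isn't a GRing.unit -> s1 u = c * u.
  have [pc1|pc1] := Zpk_sqr_fix p_prime p_gt2 k_gt0 pc.
    exists 1%g; first exact: (group1 (orth_group q1)).
    by move=> u /(Zpk_nonunitP p_prime k_gt0)[y ->]; rewrite perm1 mulrCA mulrA pc1.
  exists t => // u /(Zpk_nonunitP p_prime k_gt0)[y ->]; rewrite tE mulrCA mulrA pc1.
  by rewrite mulNr.
exists s1, s2; split=> // u v nu; exists (l v) => //.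
have -> : (u, v) = (u, 0) + (0, v) :> Z * A2.
  by rewrite -[RHS]/(u + 0, 0 + v) addr0 add0r.
have -> : (u, 0) = (1, 0) *+ u :> Z * A2 by rewrite pair_mulrn /= mul0rn natr_Zp.
rewrite sD (orth_Mn _ _ sO) pair_mulrn s1E // s2E.
have -> : (s (1, 0)).2 *+ u = 0.
  move: nu; rewrite -{1}[u]natr_Zp Zpk_unit_nat // negbK => /dvdnP[m ->].
  by rewrite mulnC mulrnA pA2 mul0rn.
rewrite [s (0, v)]surjective_pairing -/(l v) -/(g v).
by rewrite -[LHS]/(_ + _, _ + _) add0r -/c -mulr_natr natr_Zp.
Qed.

Lemma orth_pair s1 s2 : s1 \in orth q1 -> s2 \in orth q2 ->
  exists2 s : {perm Z * A2}, s \in orth q & forall x, s x = (s1 x.1, s2 x.2).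
Proof.
move=> /orthP[s1D s1q] /orthP[s2D s2q].
apply: (isometry_orth fqf (f := fun x => (s1 x.1, s2 x.2))) => [x y|x].
  by rewrite /= s1D s2D.
by rewrite /orthogonal_sum /= s1q s2q.
Qed.

(** Composing s with O(A_1) x O(A_2) leaves the sum over O(A) unchanged. For fixed s, the elements
    s1 and s2 of [orth_nonunit] are then absorbed by translation, and the double sum factors. *)
Lemma sum_nonunit (u : Z) (v : A2) : u \isn't a GRing.unit ->
  #|orth q1|%:R * #|orth q2|%:R * \sum_(s in orth q) e (bil q (u, v) (s (u, v)))
  = #|orth q|%:R * ((\sum_(s in orth q1) e (bil q1 u (s u)))
                  * (\sum_(s in orth q2) e (bil q2 v (s v)))).
Proof.
move=> nu; set B1 := \sum_(s in orth q1) _; set B2 := \sum_(s in orth q2) _.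
set S := \sum_(s in _) _.
pose f s := \sum_(t1 in orth q1) \sum_(t2 in orth q2)
  e (bil q (u, v) (t1 (s (u, v)).1, t2 (s (u, v)).2)).
transitivity (\sum_(s in orth q) f s).
  rewrite /f exchange_big /= -mulrA !mulr_natl -sumr_const; apply: eq_bigr => t1 t1O.
  rewrite exchange_big /= -sumr_const; apply: eq_bigr => t2 t2O.
  have [t tO tE] := orth_pair t1O t2O.
  rewrite /S (reindex_inj (mulIg t)) /=; apply: eq_big => [s|s _].
    by rewrite [LHS](@groupMr _ (orth_group q)).
  by rewrite permM tE.
rewrite mulr_natl -sumr_const; apply: eq_bigr => s sO.
have [s1 [s2 [s1O s2O sE]]] := orth_nonunit sO.
rewrite /f; have [l lp ->] := sE u v nu; rewrite /B1 /B2.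
rewrite -[X in _ = X * _](sum_orthMr _ s1O) -[X in _ = _ * X](sum_orthMr _ s2O).
rewrite mulr_suml.
apply: eq_bigr => t1 t1O; rewrite mulr_sumr; apply: eq_bigr => t2 t2O.
rewrite bil_orthogonal_sum /= eQZD !permM; congr (e _ * _).
have /orthP[t1D _] := t1O; rewrite t1D bilDr //.
(* The error is p-torsion and u is a multiple of p, so they are orthogonal. *)
have -> : bil q1 u (t1 l) = 0; last by rewrite addr0.
have [y ->] := Zpk_nonunitP p_prime k_gt0 nu.
rewrite bil_Aform // [p%:R * y]mulrC -!mulrA.
have t10 : t1 0 = 0 by have := orth_Mn 0 0 t1O; rewrite !mulr0n.
by rewrite [p%:R * _]mulr_natl -(orth_Mn _ _ t1O) lp t10 !mulr0 ZnQZ0.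
Qed.

(** Unit first coordinates cancel both in A and in A_1; at each remaining vector [sum_nonunit]
    factors the average over O(A). *)
Lemma gauss_mixed_sum :
  gauss R q (orth_group q) = gauss R q1 (orth_group q1) * gauss R q2 (orth_group q2).
Proof.
have card0 (A : finZmodType) (q' : A -> QZ) : #|orth q'|%:R != 0 :> R[i].
  by rewrite pnatr_eq0 -lt0n (cardG_gt0 (orth_group q')).
rewrite !gauss_average //=.
have -> : \sum_x \sum_(s in orth q) e (bil q x (s x)) =
   \sum_(u : Z | u \isn't a GRing.unit) \sum_v \sum_(s in orth q) e (bil q (u, v) (s (u, v))).
  rewrite [RHS]pair_big_dep /= (bigID (fun x : Z * A2 => x.1 \is a GRing.unit)) /=.
  rewrite [X in X + _](_ : _ = 0) ?add0r; last first.
    rewrite exchange_big /= big1 // => s sO; rewrite -[RHS](sum_unit_part sO).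
    by apply: eq_bigl => x; rewrite inE.
  apply: eq_big => [[u v]|[u v] _] //=; by rewrite andbT.
have -> : \sum_x \sum_(s in orth q1) e (bil q1 x (s x)) =
   \sum_(u : Z | u \isn't a GRing.unit) \sum_(s in orth q1) e (bil q1 u (s u)).
  rewrite (bigID (fun x : Z => x \is a GRing.unit)) /= [X in X + _](_ : _ = 0) ?add0r //.
  rewrite exchange_big /= big1 // => s sO; rewrite -[RHS](sum_unit_part1 sO).
  by apply: eq_bigl => x; rewrite inE.
rewrite [RHS]mulrACA -invfM mulr_suml !mulr_sumr; apply: eq_bigr => u nu.
rewrite !mulr_sumr; apply: eq_bigr => v _.
have N0 : #|orth q1|%:R * #|orth q2|%:R != 0 :> R[i] by rewrite mulf_neq0.
apply: (mulfI N0); rewrite [LHS]mulrCA sum_nonunit //.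
rewrite (mulKf (card0 _ q)).
by rewrite (mulVKf N0).
Qed.

End MixedSum.

(** Splits the Gauss sum of a diagonal form into one-variable sums. *)
Lemma sum_prod_row (S : comNzRingType) (T : finType) (m : nat) (h : 'I_m -> T -> S) :
  \sum_(u : 'rV[T]_m) \prod_i h i (u 0 i) = \prod_i \sum_x h i x.
Proof.
rewrite bigA_distr_bigA /=.
rewrite (reindex (fun f : {ffun 'I_m -> T} => \row_i f i)) /=.
  by apply: eq_bigr => f _; apply: eq_bigr => i _; rewrite mxE.
exists (fun u : 'rV[T]_m => [ffun i => u 0 i]) => [f|u] _.
  by apply/ffunP=> i; rewrite ffunE mxE.
by apply/rowP=> i; rewrite mxE ffunE.
Qed.

(** * Diagonalization of symmetric matrices *)

Section Diagonalization.
Variable F : fieldType.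
Hypothesis two_neq0 : (2%:R : F) != 0.

(** A nonzero diagonal entry is the norm of a basis vector. If the diagonal vanishes and M_ij is
    nonzero, then e_i + e_j has norm 2 M_ij. *)
Lemma sym_anisotropic m (M : 'M[F]_m) : M^T = M -> M != 0 ->
  exists v : 'rV_m, (v *m M *m v^T) 0 0 != 0.
Proof.
move=> symM M0; case: (pickP (fun i => M i i != 0)) => [i Mii|Md].
  exists (delta_mx 0 i); rewrite -rowE trmx_delta -colE !mxE //.
have [i [j Mij]] : exists i j, M i j != 0.
  have /matrix0Pn // : M != 0 by [].
exists (delta_mx 0 i + delta_mx 0 j).
have E k l : (delta_mx (0 : 'I_1) k *m M *m (delta_mx (0 : 'I_1) l)^T) 0 0 = M k l.
  by rewrite -rowE trmx_delta -colE !mxE.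
have Mdd k : M k k = 0 by have := Md k => /negbFE /eqP.
have Mji : M j i = M i j by rewrite -[in LHS]symM mxE.
have addE (X Y : 'M[F]_1) : (X + Y) 0 0 = X 0 0 + Y 0 0 by rewrite mxE.
rewrite raddfD /= mulmxDl mulmxDr !mulmxDl !addE.
rewrite !E !Mdd Mji add0r addr0 -mulr2n -[_ *+ 2]mulr_natl.
by rewrite mulf_neq0.
Qed.

(** Make a vector of nonzero norm the first basis vector, clear the first row and column, and
    recurse on the Schur complement. *)
Lemma sym_diagonalization m (M : 'M[F]_m) : M^T = M ->
  exists P D, P \in unitmx /\ P *m M *m P^T = diag_mx D.
Proof.
elim: m M => [|m IH] M symM.
  by exists 1%:M, 0; rewrite unitmx1; split=> //; apply/matrixP=> -[].
have [->|M0] := eqVneq M 0.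
  by exists 1%:M, 0; rewrite unitmx1 mulmx0 mul0mx raddf0.
have [v vM] := sym_anisotropic symM M0.
(* An invertible matrix whose first row is proportional to v. *)
pose Q := row_ebase v; have uQ : Q \in unitmx := row_ebase_unit v.
have [c vE] : exists c, v = c *: row 0 Q.
  exists ((col_ebase v) 0 0 * (pid_mx (\rank v) : 'M_(1, m.+1)) 0 0).
  rewrite -{1}[v]mulmx_ebase {1}[col_ebase v]mx11_scalar mul_scalar_mx -scalemxAl -scalerA.
  congr (_ *: _); rewrite -/Q; apply/rowP=> j; rewrite !mxE (bigD1 0) //= big1 ?addr0 //.
    by rewrite mxE.
  by case=> -[|i] ip // _; rewrite mxE /= mul0r.
pose M1 : 'M_(1 + m) := Q *m M *m Q^T.
have symM1 : M1^T = M1 by rewrite /M1 !trmx_mul trmxK symM mulmxA.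
pose al := M1 0 0.
have al0 : al != 0.
  apply: contraNneq vM => al0; rewrite vE -!scalemxAl linearZ /= -scalemxAr !scalerA.
  rewrite mxE; have -> : (row 0 Q *m M *m (row 0 Q)^T) 0 0 = al.
    by rewrite tr_row -!row_mul [Q *m M *m _]lock !mxE -lock /al /M1 !mxE; apply: eq_bigr => j _; rewrite !mxE.
  by rewrite al0 mulr0.
pose b := ursubmx M1; pose d := drsubmx M1.
have M1E : M1 = block_mx al%:M b b^T d.
  rewrite -[LHS]submxK; congr block_mx; last 1 first.
  - by rewrite /b trmx_ursub symM1.
  by rewrite [ulsubmx _]mx11_scalar; congr _%:M; rewrite mxE mxE /al; congr (M1 _ _); apply: val_inj.
pose L : 'M_(1 + m) := block_mx 1%:M 0 (- al^-1 *: b^T) 1%:M.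
pose N := d - al^-1 *: (b^T *m b).
have LM : L *m M1 *m L^T = block_mx al%:M 0 0 N.
  rewrite M1E /L tr_block_mx !mulmx_block !trmx1 !trmx0 linearZ /= trmxK.
  rewrite !mul1mx !mul0mx !mulmx1 !mulmx0 !addr0.
  have -> : (- al^-1 *: b^T) *m al%:M = - b^T.
    by rewrite mul_mx_scalar scalerA mulrN divff // scaleN1r.
  have -> : al%:M *m (- al^-1 *: b) = - b.
    by rewrite mul_scalar_mx scalerA mulrN divff // scaleN1r.
  by rewrite !addNr mul0mx add0r -scalemxAl scaleNr addrC.
have symN : N^T = N.
  rewrite /N raddfB /= linearZ /= trmx_mul trmxK; congr (_ - _).
  by rewrite /d trmx_drsub symM1.
have [P' [D' [uP' PD']]] := IH N symN.
pose P : 'M_(1 + m) := block_mx 1%:M 0 0 P'.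
have uP : P \in unitmx by rewrite unitmxE /P det_ublock det1 mul1r -unitmxE.
have uL : L \in unitmx by rewrite unitmxE /L det_lblock !det1 mul1r unitr1.
exists (P *m L *m Q), (row_mx al%:M D'); split.
  by rewrite !unitmx_mul uQ andbT; apply/andP.
have -> : P *m L *m Q *m M *m (P *m L *m Q)^T = P *m (L *m M1 *m L^T) *m P^T.
  by rewrite /M1 !trmx_mul !mulmxA.
rewrite LM /P tr_block_mx !mulmx_block !trmx1 !trmx0.
rewrite !mul1mx !mul0mx !mulmx1 !mulmx0 !addr0 !add0r PD'.
rewrite mul0mx.
have alE : (al%:M : 'M[F]_1) = diag_mx (al%:M : 'rV[F]_1).
  by apply/matrixP=> i j; rewrite !mxE !ord1.
by have := diag_mx_row (al%:M : 'rV[F]_1) D'; rewrite -alE => ->.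
Qed.

End Diagonalization.

(** * Elementary forms: orbits by reflections, orbit sums by characters *)

Section ElementaryForm.
Variables (R : realType) (p : nat).
Hypotheses (p_prime : prime p) (p_gt2 : (2 < p)%N).
Variables (A : finZmodType) (q : A -> QZ).
Hypotheses (fqf : finite_quadratic_form q) (pA : forall x : A, x *+ p = 0).
Local Notation F := 'F_p.
Local Notation chi := (chi R).

Definition Fbil (x y : A) : F := QZtoFp p (bil q x y).
Local Notation B := Fbil.
Local Notation N x := (Fbil x x).

Let two0 : (2%:R : F) != 0 := Fp_two_neq0 p_prime p_gt2.

Lemma FbilE x y : FpQZ (B x y) = bil q x y.
Proof. by rewrite QZtoFpK // -bilMnl // pA bil0l. Qed.

Lemma chi_Fbil x y : eQZ R (bil q x y) = chi (B x y).
Proof. by rewrite -FbilE. Qed.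

Lemma FbilC x y : B x y = B y x.
Proof. by rewrite /Fbil bilC. Qed.

Lemma FbilDl x y z : B (x + y) z = B x z + B y z.
Proof. by apply: (FpQZ_inj p_prime); rewrite FpQZD // !FbilE bilDl. Qed.

Lemma FbilDr x y z : B z (x + y) = B z x + B z y.
Proof. by rewrite FbilC FbilDl ![B z _]FbilC. Qed.

Lemma Fbil0l x : B 0 x = 0.
Proof. by apply: (FpQZ_inj p_prime); rewrite FbilE bil0l // FpQZ0. Qed.

Lemma Fbil0r x : B x 0 = 0.
Proof. by rewrite FbilC Fbil0l. Qed.

Lemma FbilNl x y : B (- x) y = - B x y.
Proof. by apply: (FpQZ_inj p_prime); rewrite FpQZN // !FbilE bilNl. Qed.

Lemma FbilNr x y : B x (- y) = - B x y.
Proof. by rewrite FbilC FbilNl FbilC. Qed.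

Lemma FbilMl (c : F) x y : B (x *+ c) y = c * B x y.
Proof.
have H n : B (x *+ n) y = n%:R * B x y.
  elim: n => [|n IH]; first by rewrite mulr0n Fbil0l mul0r.
  by rewrite mulrS FbilDl IH -natr1 mulrDl mul1r addrC.
by rewrite H natr_Zp.
Qed.

Lemma FbilMr (c : F) x y : B x (y *+ c) = c * B x y.
Proof. by rewrite FbilC FbilMl FbilC. Qed.

Definition Fbil_simp := (FbilDl, FbilDr, FbilNl, FbilNr, FbilMl, FbilMr).

Lemma Fbil_nondeg x : (forall y, B x y = 0) -> x = 0.
Proof.
have [_ _ _ nd] := fqf => Bx; apply: nd => y.
by rewrite -FbilE Bx FpQZ0.
Qed.

Lemma Fbil_inj x y : (forall z, B x z = B y z) -> x = y.
Proof.
move=> Bxy; apply/eqP; rewrite -subr_eq0; apply/eqP/Fbil_nondeg => z.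
by rewrite FbilDl FbilNl Bxy subrr.
Qed.

Lemma Fbil_neq0 x : x != 0 -> exists y, B x y != 0.
Proof.
move=> x0; case: (pickP (fun y => B x y != 0)) => [y By|Bx]; first by exists y.
by case/eqP: x0; apply: Fbil_nondeg => y; apply/eqP/negbFE/Bx.
Qed.

(** Both p^2 q(x) = q(p x) and 2 p q(x) = p (x, x) vanish, and p is odd. *)
Lemma q_torsion x : q x *+ p = 0.
Proof.
have [qM _ _ _] := fqf.
have pp : q x *+ (p * p) = 0.
  have q0 : q 0 = 0 by have := qM 0 0; rewrite mulr0z expr0n mulr0z.
  have := qM p%:Z x; rewrite -pmulrn pA q0 => /esym.
  by rewrite -[(p%:Z ^+ 2)]/((p * p)%N%:Z).
have := bil_diag fqf x => /(congr1 (fun z => z *+ p)).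
rewrite -bilMnl // pA bil0l // => /esym q2p.
have ppE : (p * p = 2 * p * (p.-1)./2 + p)%N.
  by have := odd_prime_half p_prime p_gt2; nia.
by move: pp; rewrite ppE mulrnDr !mulrnA q2p mul0rn add0r.
Qed.

(** Since p q(x) = 0, q(x) is (p + 1) / 2 times 2 q(x) = (x, x). To build isometries it thus
    suffices to preserve the F_p-valued norm. *)
Lemma q_of_Fbil x y : N x = N y -> q x = q y.
Proof.
move/(congr1 (@FpQZ p)); rewrite !FbilE !bil_diag // => xy.
have qE z : q z = q z *+ 2 *+ (p.-1)./2.+1.
  rewrite -mulrnA mulnS mul2n addnC addn2 -(odd_prime_half p_prime p_gt2) //.
  by rewrite mulrS q_torsion addr0.
by rewrite qE xy -qE.
Qed.

Lemma Fbil_orth (s : {perm A}) x y : s \in orth q -> B (s x) (s y) = B x y.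
Proof. by move=> sO; rewrite /Fbil bil_orth. Qed.

(** Reflection in the hyperplane orthogonal to w; the scalar acts on the abelian group A through its
    natural representative. *)
Definition refl w y := y - w *+ (2%:R * B y w / N w : F).

Lemma refl_orth w : N w != 0 ->
  exists2 s : {perm A}, s \in orth q & forall y, s y = refl w y.
Proof.
move=> w0; apply: (isometry_orth fqf) => [x y|x].
  by apply: Fbil_inj => z; rewrite /refl !Fbil_simp; field.
by apply: q_of_Fbil; rewrite /refl !Fbil_simp [B w x]FbilC; field.
Qed.

Lemma refl_move x y : N x = N y -> N (x - y) != 0 ->
  exists2 s : {perm A}, s \in orth q & s x = y.
Proof.
move=> xy d0; have [s sO sE] := refl_orth d0; exists s => //.
rewrite sE /refl; have -> : 2%:R * B x (x - y) / N (x - y) = 1.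
  have -> : 2%:R * B x (x - y) = N (x - y).
    by rewrite !Fbil_simp -xy [B y x]FbilC; ring.
  by rewrite divff.
by apply: Fbil_inj => z; rewrite !Fbil_simp; ring.
Qed.

Lemma orth_comp (x y z : A) : (exists2 s : {perm A}, s \in orth q & s x = y) ->
  (exists2 s : {perm A}, s \in orth q & s y = z) ->
  exists2 s : {perm A}, s \in orth q & s x = z.
Proof.
move=> [s sO sx] [t tO ty]; exists (s * t)%g; last by rewrite permM sx ty.
exact: (@groupM _ (orth_group q)).
Qed.

(** Reflection in x - y exchanges x and y unless x - y is isotropic. In that case, if N x is
    nonzero, x + y has norm 4 N x, so x can be reflected to -y and then negated. If N x = 0, two
    reflections pass through an isotropic z orthogonal to neither vector. *)
Lemma witt_vector x y : x != 0 -> y != 0 -> N x = N y ->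
  exists2 s : {perm A}, s \in orth q & s x = y.
Proof.
move=> x0 y0 xy; have [d0|] := eqVneq (N (x - y)) 0; last exact: refl_move.
have Bxy : B x y = N x.
  apply: (mulfI two0); apply/eqP; rewrite eq_sym -subr_eq0 -d0 !Fbil_simp -xy [B y x]FbilC.
  by apply/eqP; ring.
have [Nx0|Nx] := eqVneq (N x) 0; last first.
  apply: (@orth_comp _ (- y)).
    apply: refl_move; first by rewrite !Fbil_simp opprK.
    have -> : N (x - - y) = 2%:R * 2%:R * N x.
      by rewrite opprK !Fbil_simp -xy [B y x]FbilC Bxy; ring.
    by rewrite !mulf_neq0.
  by have [t tO tE] := orth_opp fqf; exists t => //; rewrite tE opprK.
have [w [xw yw]] : exists w, B x w != 0 /\ B y w != 0.
  have [w1 xw1] := Fbil_neq0 x0; have [w2 yw2] := Fbil_neq0 y0.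
  have [yw1|] := eqVneq (B y w1) 0; last by exists w1.
  have [xw2|] := eqVneq (B x w2) 0; last by exists w2.
  by exists (w1 + w2); rewrite !FbilDr xw2 yw1 addr0 add0r.
(* The multiple of x makes w isotropic, and leaves its products with x and y unchanged since x is
   orthogonal to both. *)
pose z := w - x *+ (N w / (2%:R * B x w) : F).
have Nz : N z = 0.
  by rewrite /z !Fbil_simp Nx0 [B w x]FbilC; field; rewrite xw two0.
have xz : B x z != 0 by rewrite /z !Fbil_simp Nx0 mulr0 subr0.
have yz : B y z != 0 by rewrite /z !Fbil_simp [B y x]FbilC Bxy Nx0 mulr0 subr0.
clearbody z; apply: (@orth_comp _ z); apply: refl_move; rewrite ?Nz -?xy ?Nx0 //.
  have -> : N (x - z) = - (2%:R * B x z) by rewrite !Fbil_simp Nx0 Nz [B z x]FbilC; ring.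
  by rewrite oppr_eq0 mulf_neq0.
have -> : N (z - y) = - (2%:R * B y z) by rewrite !Fbil_simp -xy Nx0 Nz [B z y]FbilC; ring.
by rewrite oppr_eq0 mulf_neq0.
Qed.

Lemma orth_orbit x : x != 0 ->
  orbit 'P (orth_group q) x = [set y | (y != 0) && (N y == N x)].
Proof.
move=> x0; apply/setP=> y; rewrite inE; apply/orbitP/andP => [[s sO <-]|[y0 /eqP yx]].
  rewrite /= apermE Fbil_orth //; split=> //; apply: contra_neq x0 => sx0.
  apply: (@perm_inj _ s); rewrite sx0.
  by have := orth_Mn 0 0 sO; rewrite !mulr0n.
by have [s sO sx] := witt_vector x0 y0 (esym yx); exists s.
Qed.

Definition qgauss (t : F) : R[i] := \sum_y chi (t * N y).

Lemma sum_chi_Fbil x : x != 0 -> \sum_y chi (B x y) = 0.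
Proof.
move=> /Fbil_neq0[w xw]; set S := \sum_y _.
have e1 : chi (B x w) - 1 != 0 by rewrite subr_eq0 chi_eq1.
apply: (mulfI e1); rewrite mulr0 mulrBl mul1r; apply/eqP; rewrite subr_eq0.
rewrite [X in _ == X](reindex_inj (addrI w)) mulr_sumr; apply/eqP.
by apply: eq_bigr => c _; rewrite FbilDr chiD.
Qed.

(** By [sphere_sumE], p times the sum of [chi (B x y)] over the y of norm c = N x, for x nonzero. As
    a formula in c alone it can be summed over all c, attained or not. *)
Definition sphere_sum (c : F) : R[i] :=
  \sum_(t | t != 0) chi (- (t * c) - c / (2%:R * 2%:R * t)) * qgauss t.

(* Detect N y = N x by an additive character of t, then complete the square in y. *)
Lemma sphere_sumE x : x != 0 ->
  p%:R * \sum_(y | N y == N x) chi (B x y) = sphere_sum (N x).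
Proof.
move=> x0.
transitivity (\sum_y \sum_t chi (B x y) * chi ((N y - N x) * t)).
  rewrite mulr_sumr [RHS](bigID (fun y => N y == N x)) /= [X in _ = _ + X]big1.
    rewrite addr0; apply: eq_bigr => y /eqP ->.
    by rewrite -mulr_sumr sum_chi // subrr eqxx mulrC.
  by move=> y yx; rewrite -mulr_sumr sum_chi // subr_eq0 (negPf yx) mulr0.
rewrite exchange_big /= (bigD1 (0 : F)) //= [X in X + _](_ : _ = 0) ?add0r; last first.
  by under eq_bigr do rewrite mulr0 chi0 // mulr1; rewrite sum_chi_Fbil.
(* The shift of y by - x / (2 t) removes the linear term. *)
apply: eq_bigr => t t0; have [c cE] : exists c : F, c = - (2%:R * t)^-1 by exists (- (2%:R * t)^-1).
rewrite (reindex_inj (addIr (x *+ c))) /= mulr_sumr; apply: eq_bigr => y _.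
rewrite -!chiD //; congr (eQZ R (FpQZ _)); rewrite !Fbil_simp [B y x]FbilC cE; field.
by rewrite t0 two0 (natrM _ 2 2) mulf_neq0.
Qed.

(** The orbit {0} gives 1, and the nonzero vectors of each attained norm form one orbit. The sphere
    of norm 0 also contains the zero vector, whose contribution 1 is subtracted. *)
Lemma gauss_values : gauss R q (orth_group q) =
  1 + \sum_(c : F | [exists x, (x != 0) && (N x == c)])
        (p%:R^-1 * sphere_sum c - (c == 0)%:R).
Proof.
have p0 : p%:R != 0 :> R[i] by rewrite pnatr_eq0 -lt0n prime_gt0.
have G0 : #|orth_group q|%:R != 0 :> R[i] by rewrite pnatr_eq0 -lt0n cardG_gt0.
rewrite gauss_average // (bigD1 0) //= mulrDr; congr (_ + _).
  under eq_bigr do rewrite bil0l // eQZ0.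
  by rewrite sumr_const mulVf.
rewrite mulr_sumr (partition_big (fun x => N x) (fun c => [exists x, (x != 0) && (N x == c)])) /=;
  last by move=> x x0; apply/existsP; exists x; rewrite x0 eqxx.
apply: eq_bigr => c /existsP[z /andP[z0 /eqP zc]].
pose S := [set y | (y != 0) && (N y == c)].
have S0 : #|S|%:R != 0 :> R[i].
  by rewrite pnatr_eq0 -lt0n card_gt0; apply/set0Pn; exists z; rewrite inE z0 zc eqxx.
set h := _ - _.
transitivity (\sum_(x in S) (#|S|%:R^-1 * h)); last first.
  by rewrite sumr_const -[LHS]mulr_natl mulVKf.
apply: eq_big => [x|x /andP[x0 /eqP xc]]; first by rewrite inE.
rewrite (orbit_average (orth_group q) (fun y => eQZ R (bil q x y))) orth_orbit // xc -/S.
congr (_ * _); rewrite /h -xc -sphere_sumE // mulKf //.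
under [LHS]eq_bigr do rewrite chi_Fbil.
rewrite [X in X - _](bigID (fun y => y != 0)) /=.
rewrite [X in _ + X - _](_ : _ = (N x == 0)%:R); last first.
  have [Nx0|Nx0] := eqVneq (N x) 0.
    rewrite (big_pred1 0) ?Fbil0r ?chi0 // => y /=.
    by rewrite negbK andbC; case: eqP => //= ->; rewrite Fbil0l Nx0 eqxx.
  rewrite big_pred0 // => y; rewrite negbK andbC; case: eqP => //= ->.
  by rewrite Fbil0l eq_sym (negPf Nx0).
rewrite addrK; apply: eq_bigl => y; rewrite inE xc andbC //.
Qed.

(** Summing over c the character of -(t + 1 / (4 t)) c leaves only the t with 4 t^2 = -1. *)
Lemma sum_sphere_sum :
  \sum_c p%:R^-1 * sphere_sum c = \sum_(t : F | (2%:R * t) ^+ 2 == -1) qgauss t.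
Proof.
have p0 : p%:R != 0 :> R[i] by rewrite pnatr_eq0 -lt0n prime_gt0.
rewrite -mulr_sumr /sphere_sum exchange_big /=.
have inner (t : F) : t != 0 ->
  \sum_c chi (- (t * c) - c / (2%:R * 2%:R * t)) * qgauss t
  = if (2%:R * t) ^+ 2 == -1 then p%:R * qgauss t else 0.
  move=> t0; rewrite -mulr_suml.
  have -> : \sum_c chi (- (t * c) - c / (2%:R * 2%:R * t)) =
    \sum_c chi (- (t + (2%:R * 2%:R * t)^-1) * c).
    by apply: eq_bigr => c _; congr (eQZ R (FpQZ _)); ring.
  rewrite sum_chi // oppr_eq0.
  have -> : (t + (2%:R * 2%:R * t)^-1 == 0) = ((2%:R * t) ^+ 2 == -1).
    have d0 : 2%:R * 2%:R * t != 0 by rewrite !mulf_neq0.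
    rewrite -(inj_eq (mulfI d0)) mulr0 mulrDr divff // -addr_eq0.
    by congr (_ == 0); ring.
  by case: ifP => // _; rewrite mul0r.
rewrite (eq_bigr _ inner) mulr_sumr [LHS]big_mkcond [RHS]big_mkcond; apply: eq_bigr => t _.
have [->|t0] := eqVneq t 0; last by case: ifP => _; rewrite ?mulr0 ?mulKf.
by rewrite mulr0 expr0n eq_sym oppr_eq0 oner_eq0.
Qed.

(** Adding multiples of an isotropic x to a vector w not orthogonal to it attains every norm. The
    term subtracted at c = 0 then cancels the leading 1 of [gauss_values]. *)
Lemma gauss_isotropic : (exists2 x, x != 0 & N x = 0) ->
  gauss R q (orth_group q) = \sum_(t : F | (2%:R * t) ^+ 2 == -1) qgauss t.
Proof.
move=> [x x0 Nx]; rewrite gauss_values -sum_sphere_sum.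
have all c : [exists x, (x != 0) && (N x == c)].
  have [w xw] := Fbil_neq0 x0; apply/existsP.
  exists (w + x *+ ((c - N w) / (2%:R * B x w) : F)); apply/andP; split.
    apply: contraNneq xw => y0; rewrite -(Fbil0r x) -y0 !Fbil_simp Nx.
    by rewrite mulr0 addr0.
  by apply/eqP; rewrite !Fbil_simp Nx [B w x]FbilC; field; rewrite xw two0.
rewrite (eq_bigl predT) => [|c]; last by rewrite all.
rewrite big_split /= sumrN addrCA -[RHS]addr0; congr (_ + _).
rewrite (bigD1 (0 : F)) //= big1 => [|c /negPf -> //].
by rewrite addr0 subrr.
Qed.

Section Coordinates.
Variables (m : nat) (f : {additive 'rV[F]_m -> A}).
Hypothesis f_bij : coordinates f.
Local Notation M := (gram q f).

Lemma Fbil_gram v w : B (f v) (f w) = (v *m M *m w^T) 0 0.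
Proof.
have fZ (c : F) u : f (c *: u) = f u *+ c.
  by rewrite -raddfMn -scaler_nat natr_Zp.
rewrite {1}[v]row_sum_delta {1}[w]row_sum_delta !raddf_sum /=.
have sumL (I : finType) (g : I -> A) y : B (\sum_i g i) y = \sum_i B (g i) y.
  by apply: (big_morph (fun x => B x y)) => [a b|]; rewrite ?FbilDl ?Fbil0l.
have sumR (I : finType) (g : I -> A) y : B y (\sum_i g i) = \sum_i B y (g i).
  by apply: (big_morph (fun x => B y x)) => [a b|]; rewrite ?FbilDr ?Fbil0r.
rewrite sumR mxE; apply: eq_bigr => j _; rewrite sumL !mxE mulr_suml.
apply: eq_bigr => i _; rewrite !fZ FbilMl FbilMr !mxE /Fbil.
by rewrite mulrA mulrAC.
Qed.

Lemma gram_sym : M^T = M.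
Proof. by apply/matrixP=> i j; rewrite !mxE bilC. Qed.

Lemma gram_det_neq0 : \det M != 0.
Proof.
apply/det0P => -[v v0 vM]; case/eqP: v0; apply: (bij_inj f_bij).
rewrite raddf0; apply: Fbil_nondeg => y; have [g fg gf] := f_bij.
by rewrite -[y]gf Fbil_gram vM mul0mx mxE.
Qed.

(** Diagonalizing the Gram matrix factors the sum into one-variable sums, each giving the Legendre
    symbol of t D_i times [gaussF]. The change of basis alters the determinant by a square. *)
Lemma qgauss_gram t : t != 0 -> qgauss t =
  ((legendre t) ^+ m * legendre (\det M))%:~R * gaussF R p ^+ m.
Proof.
move=> t0; have [P [D [uP PD]]] := sym_diagonalization two0 gram_sym.
have detD : \prod_i D 0 i = \det P ^+ 2 * \det M.
  by rewrite -det_diag -PD !det_mulmx det_tr; ring.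
have P0 : \det P != 0 by rewrite -unitfE -unitmxE.
have D0 i : D 0 i != 0.
  have : \prod_i D 0 i != 0 by rewrite detD mulf_neq0 ?expf_neq0 ?gram_det_neq0.
  by move/prodf_neq0; apply.
rewrite /qgauss (reindex f) /=; last exact: onW_bij.
have mulP_inj : injective (fun u : 'rV[F]_m => u *m P).
  by move=> u v /(congr1 (fun x => x *m invmx P)); rewrite !mulmxK.
rewrite (reindex_inj mulP_inj) /=.
transitivity (\sum_(u : 'rV[F]_m) \prod_i chi (t * D 0 i * u 0 i ^+ 2)).
  apply: eq_bigr => u _; rewrite Fbil_gram.
  have -> : u *m P *m M *m (u *m P)^T = u *m diag_mx D *m u^T.
    by rewrite -PD trmx_mul !mulmxA.
  have chiS (g : 'I_m -> F) : chi (\sum_i g i) = \prod_i chi (g i).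
    by apply: big_morph => [x y|]; rewrite ?chiD ?chi0.
  rewrite mxE mulr_sumr chiS; apply: eq_bigr => i _; congr (eQZ R (FpQZ _)).
  by rewrite mul_mx_diag !mxE; ring.
rewrite (sum_prod_row (fun i x => chi (t * D 0 i * x ^+ 2))).
under eq_bigr => i _ do rewrite sum_chi_sqrM ?mulf_neq0 //.
rewrite big_split /= prodr_const card_ord; congr (_ * _).
rewrite -rmorph_prod; congr (_%:~R).
under eq_bigr do rewrite legendreM //.
rewrite big_split /= prodr_const card_ord -legendre_prod // detD legendreM //.
by rewrite legendre_sqr ?mul1r.
Qed.

Lemma card_coordinates : #|A| = (p ^ m)%N.
Proof. by rewrite -(bij_eq_card f_bij) card_mx card_Fp // mul1n. Qed.

End Coordinates.

End ElementaryForm.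

(** * Gauss sums of elementary forms: isotropic case and anisotropic plane *)

Section ElementaryTheorem.
Variables (R : realType) (p : nat).
Hypotheses (p_prime : prime p) (p_gt2 : (2 < p)%N).
Variables (m : nat) (A : finZmodType) (q : A -> QZ).
Hypothesis qE : elementary_form p m q.
Local Notation F := 'F_p.

Let fqf : finite_quadratic_form q := proj1 qE.
Let pA : forall x : A, x *+ p = 0 := elementary_torsion p_prime qE.

Lemma isotropicP x : isotropic q x <-> Fbil p q x x = 0.
Proof.
rewrite /isotropic -(FbilE p_prime fqf pA); split=> [/eqP|->].
  by rewrite FpQZ_eq0 // => /eqP.
exact: FpQZ0.
Qed.

(** For p = 3 mod 4 the equation (2 t)^2 = -1 has no solution. For p = 1 mod 4 its solutions are
    delta / 2 and - delta / 2, both with the Legendre symbol of 2 delta, whence the factor 2. *)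
Lemma gauss_elementary_isotropic : has_isotropic q ->
  ((p = 3 %[mod 4])%N -> gauss R q (orth_group q) = 0) /\
  ((p = 1 %[mod 4])%N -> forall delta d : 'F_p,
     delta ^+ 2 = - 1 -> is_disc m q d ->
     gauss R q (orth_group q)
     = 2%:R * ((legendre (2%:R * delta)) ^+ m)%:~R * (legendre d)%:~R
       * (Num.sqrt (#|A|%:R : R))%:C).
Proof.
have ph := odd_prime_half p_prime p_gt2.
have two0 := Fp_two_neq0 p_prime p_gt2.
move=> [x [/eqP x0 /isotropicP Nx]].
rewrite (gauss_isotropic R p_prime p_gt2 fqf pA); last by exists x.
split=> [p3|p1 delta d d2 [f [fb ->]]].
  rewrite big_pred0 // => t; apply/negbTE/negP => /eqP t2.
  have t0 : 2%:R * t != 0.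
    by apply: contra_eq_neq t2 => ->; rewrite expr0n eq_sym oppr_eq0 oner_neq0.
  have := legendre_sqr t0; rewrite t2 legendreN1 // -signr_odd.
  by have -> : odd (p.-1)./2 by lia.
have on : odd (p.-1)./2 = false by lia.
have d0 : delta != 0.
  by apply: contra_eq_neq d2 => ->; rewrite expr0n eq_sym oppr_eq0 oner_neq0.
have eqt (t : F) : ((2%:R * t) ^+ 2 == -1) = (t \in [set delta / 2%:R; - (delta / 2%:R)]).
  rewrite -d2 eqf_sqr !inE -mulNr -!(inj_eq (mulfI two0) t).
  by rewrite ![2%:R * (_ / _)]mulrC !divfK.
have dn : delta / 2%:R != - (delta / 2%:R).
  rewrite -addr_eq0 -mulrDl -mulr2n -[delta *+ 2]mulr_natl mulrAC divff // mul1r.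
  exact: d0.
rewrite (eq_bigl _ _ eqt) big_setU1 ?inE //= big_set1.
rewrite !(qgauss_gram R p_prime p_gt2 fqf pA fb) ?oppr_eq0 ?mulf_neq0 ?invr_eq0 //.
have legd : legendre (delta / 2%:R) = legendre (2%:R * delta).
  have -> : 2%:R * delta = 2%:R ^+ 2 * (delta / 2%:R) by field.
  by rewrite [RHS]legendreM // legendre_sqr // mul1r.
have legN : legendre (- (delta / 2%:R)) = legendre (2%:R * delta).
  by rewrite -mulN1r [LHS]legendreM // legendreN1 // -signr_odd on mul1r.
rewrite legd legN (card_coordinates p_prime fb) gaussF_sign //.
have -> : (Num.sqrt ((p ^ m)%:R : R))%:C = (Num.sqrt (p%:R : R))%:C ^+ m.
  rewrite -rmorphXn; congr (_%:C); elim: m => [|n IH]; first by rewrite expn0 sqrtr1.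
  by rewrite expnS natrM sqrtrM ?ler0n // IH exprS.
by rewrite !rmorphM /=; ring.
Qed.

Lemma gauss_elementary_anisotropic : m = 2%N -> ~ has_isotropic q ->
  gauss R q (orth_group q) = (- 1) ^+ (p.+1 %/ 2)%N * p%:R.
Proof.
move=> m2 ani; have ph := odd_prime_half p_prime p_gt2.
have two0 := Fp_two_neq0 p_prime p_gt2.
have p0 : p%:R != 0 :> R[i] by rewrite pnatr_eq0 -lt0n prime_gt0.
have anis x : Fbil p q x x = 0 -> x = 0.
  move=> Nx; apply/eqP; apply/negPn/negP => x0; apply: ani; exists x; split; first exact/eqP.
  exact/isotropicP.
have [_ [f fb]] := qE; have cA := card_coordinates p_prime fb; rewrite m2 in cA.
pose G := qgauss R q (1 : F).
(* In dimension 2 the symbol of t enters squared, so all nonzero t give the same value. *)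
have GE (t : F) : t != 0 -> qgauss R q t = G.
  move=> t0; rewrite /G !(qgauss_gram R p_prime p_gt2 fqf pA fb) ?oner_neq0 //.
  by move: (\det _) => D; rewrite m2 legendre_sq1 // legendre1 expr1n.
have G0 : qgauss R q (0 : F) = (p ^ 2)%:R.
  rewrite /qgauss; under eq_bigr do rewrite mul0r chi0 //.
  by rewrite sumr_const cA.
have count (c : F) : p%:R * (#|[pred y | Fbil p q y y == c]|)%:R =
    \sum_t chi R (- (t * c)) * qgauss R q t.
  transitivity (\sum_y \sum_t chi R ((Fbil p q y y - c) * t)); last first.
    rewrite exchange_big /=; apply: eq_bigr => t _; rewrite /qgauss mulr_sumr.
    by apply: eq_bigr => y _; rewrite -chiD //; congr (eQZ R (FpQZ _)); ring.
  rewrite (bigID (fun y => Fbil p q y y == c)) /= [X in _ + X]big1.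
    rewrite addr0; under eq_bigr => y /eqP -> do rewrite sum_chi // subrr eqxx.
    by rewrite sumr_const mulr_natr.
  by move=> y yc; rewrite sum_chi // subr_eq0 (negPf yc).
have sumN0 : \sum_(t : F | t != 0) (1 : R[i]) = p%:R - 1.
  rewrite sumr_const; transitivity (p.-1%:R : R[i]).
    by congr (_ *+ _); have := cardC1 (0 : F); rewrite card_Fp.
  by rewrite -subn1 natrB ?prime_gt0.
(* Only the zero vector has norm 0, so the count at c = 0 reads p = p^2 + (p - 1) G. *)
have GV : G = - p%:R.
  have := count 0; rewrite (bigD1 (0 : F)) //= G0 mul0r oppr0 chi0 // mul1r.
  rewrite (@eq_card1 _ 0) => [|y]; last first.
    by rewrite !inE; apply/eqP/eqP => [/anis //|->]; rewrite Fbil0l.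
  have -> : \sum_(t : F | t != 0) chi R (- (t * 0)) * qgauss R q t = (p%:R - 1) * G.
    rewrite -sumN0 mulr_suml; apply: eq_bigr => t t0.
    by rewrite mulr0 oppr0 chi0 // GE.
  have p10 : p%:R - 1 != 0 :> R[i].
    by rewrite -[1]/(1%:R) -natrB ?prime_gt0 // pnatr_eq0 -lt0n subn_gt0 prime_gt1.
  move=> E; apply: (mulfI p10); apply: (addrI (p ^ 2)%:R); rewrite -E natrX.
  by ring.
(* For c nonzero, p times the count is p^2 - G = p^2 + p, so the norm c is attained. *)
have ex (c : F) : [exists x, (x != 0) && (Fbil p q x x == c)] = (c != 0).
  apply/existsP/idP => [[x /andP[x0 /eqP <-]]|c0].
    by apply: contra_neq x0 => /anis.
  have := count c; rewrite (bigD1 (0 : F)) //= G0 mul0r oppr0 chi0 // mul1r.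
  have -> : \sum_(t : F | t != 0) chi R (- (t * c)) * qgauss R q t = p%:R.
    have := sum_chi R p_prime (- c); rewrite oppr_eq0 (negPf c0) (bigD1 (0 : F)) //=.
    rewrite mulr0 chi0 // => /eqP; rewrite addrC addr_eq0 => /eqP E.
    rewrite [RHS](_ : _ = (-1) * G); last by rewrite GV mulrNN mul1r.
    rewrite -E mulr_suml; apply: eq_bigr => t t0; rewrite GE //.
    by congr (eQZ R (FpQZ _) * _); ring.
  have [y /eqP yc _|none] := pickP (fun y => Fbil p q y y == c).
    exists y; rewrite yc eqxx andbT; apply: contra_neq c0 => y0.
    by rewrite -yc y0 Fbil0l.
  rewrite eq_card0 ?mulr0 => [/eqP|y]; last by rewrite !inE none.
  by rewrite eq_sym -natrD pnatr_eq0 addn_eq0 (gtn_eqF (prime_gt0 p_prime)) andbF.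
rewrite (gauss_values R p_prime p_gt2 fqf pA) (eq_bigl _ _ ex).
have -> : \sum_(c : F | c != 0) (p%:R^-1 * sphere_sum R q c - (c == 0)%:R)
  = \sum_(c : F) p%:R^-1 * sphere_sum R q c - p%:R^-1 * sphere_sum R q (0 : F).
  rewrite [in RHS](bigD1 (0 : F)) //= [RHS]addrAC subrr add0r.
  by apply: eq_bigr => c /negPf ->; rewrite subr0.
rewrite sum_sphere_sum //.
have -> : sphere_sum R q (0 : F) = (p%:R - 1) * G.
  rewrite /sphere_sum -sumN0 mulr_suml; apply: eq_bigr => t t0.
  by rewrite mulr0 mul0r subr0 oppr0 chi0 // GE.
have -> : \sum_(t : F | (2%:R * t) ^+ 2 == -1) qgauss R q t
   = (1 + (legendre (-1 : F))%:~R) * G.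
  transitivity (\sum_(t : F | (2%:R * t) ^+ 2 == -1) G).
    apply: eq_bigr => t t2; apply: GE; apply: contraTneq t2 => ->.
    by rewrite mulr0 expr0n eq_sym oppr_eq0 oner_eq0.
  transitivity (\sum_(t : F | t ^+ 2 == -1) G).
    by rewrite [RHS](reindex_inj (mulfI two0)).
  rewrite sumr_const -[LHS]mulr_natl; congr (_ * _).
  rewrite -[1]/(1%:~R) -rmorphD /= -card_sqrt // natz -pmulrn.
  by congr (_%:R); apply: eq_card => t; rewrite !inE.
(* What remains is 1 - (1 + (-1/p)) p + (p - 1) = - (-1/p) p. *)
have -> : (p.+1 %/ 2 = (p.-1)./2.+1)%N by lia.
rewrite GV legendreN1 // exprS rmorphXn /= rmorphN1.
by field.
Qed.

End ElementaryTheorem.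

Theorem theorem1p1 (R : realType) (p : nat) (p_prime : prime p) (p_gt2 : (2 < p)%N) :
  (* (1) *)
  (forall (k : nat) (a : padic_int p), (1 <= k)%N -> padic_unit a ->
     ((p ^ k = 3 %[mod 4])%N -> gauss R (Aform k a) (orth_group (Aform k a)) = 0) /\
     ((p ^ k = 1 %[mod 4])%N ->
        gauss R (Aform k a) (orth_group (Aform k a))
        = ((legendre ((a 1%N)%:R : 'F_p)) ^+ k)%:~R
          * (Num.sqrt (#|{: 'Z_(p ^ k)}|%:R : R))%:C))
  /\
  (* (2), A containing a nonzero isotropic vector *)
  (forall (m : nat) (A : finZmodType) (q : A -> QZ),
     elementary_form p m q -> (1 < m)%N -> has_isotropic q ->
     ((p = 3 %[mod 4])%N -> gauss R q (orth_group q) = 0) /\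
     ((p = 1 %[mod 4])%N -> forall delta d : 'F_p,
        delta ^+ 2 = - 1 -> is_disc m q d ->
        gauss R q (orth_group q)
        = 2%:R * ((legendre (2%:R * delta)) ^+ m)%:~R * (legendre d)%:~R
          * (Num.sqrt (#|A|%:R : R))%:C))
  /\
  (* (2), A the anisotropic plane *)
  (forall (A : finZmodType) (q : A -> QZ),
     elementary_form p 2 q -> ~ has_isotropic q ->
     gauss R q (orth_group q) = (- 1) ^+ (p.+1 %/ 2)%N * p%:R)
  /\
  (* (3) *)
  (forall (k : nat) (a : padic_int p) (m : nat) (A2 : finZmodType) (q2 : A2 -> QZ),
     (1 < k)%N -> padic_unit a -> elementary_form p m q2 -> (1 <= m)%N ->
     let q1 := Aform k a in
     let q := orthogonal_sum q1 q2 in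
     gauss R q (orth_group q)
     = gauss R q1 (orth_group q1) * gauss R q2 (orth_group q2)).
Proof.
split; last split; last split.
- by move=> k a k0 ua; exact: gauss_Aform_mod4.
- by move=> m A q qE _ iso; exact: gauss_elementary_isotropic.
- by move=> A q qE ani; exact: (gauss_elementary_anisotropic R p_prime p_gt2 qE).
move=> k a m A2 q2 k1 ua qE m0 /=; apply: gauss_mixed_sum => //.
  by case: qE.
exact: elementary_torsion qE.
Qed.
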